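(* There exists $\epsilon_0>0$ such that the following holds for every constant $0<\epsilon<\epsilon_0$. Let $d=d(n)$ satisfy $d=o(n)$, $d\ge 3$, and let $p=\frac{1+\epsilon}{d}$. Assume $\frac{2}{\ln(n/d)}<\alpha<\epsilon^8$, and let $G=(V,E)$ be an $(n,d,\lambda)$-graph with $\lambda/d\le \alpha^{2/\alpha}$. Let $e(L_1)$ denote the number of edges in the giant (largest) component $L_1$ of $G[V_p]$. Then there exists a constant $\beta=\beta(\epsilon)>0$ such that with probability at least $1-\left(\frac{n}{d}\right)^{-\beta\ln\ln(n/d)}$, $$\left|e(L_1)-\frac{\left((1+\epsilon)^2-(1+\epsilon-x)^2\right)n}{2d}\right|\le \frac{8\alpha^{1/4}n}{d},$$ where $x$ is the unique solution in $(0,1)$ of $x=(1+\epsilon)(1-e^{-x})$.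
   Context: An $(n,d,\lambda)$-graph is a $d$-regular graph on $n$ vertices whose adjacency eigenvalues $d=\lambda_1\ge\lambda_2\ge\dots\ge\lambda_n$ satisfy $\lambda=\max(|\lambda_2|,|\lambda_n|)$. $V_p$ is the random subset of $V$ obtained by including each vertex independently with probability $p$, and $G[V_p]$ is the induced subgraph. The parameter $\alpha$ may depend on $n$. *)

(* Defs.v *)
From HB Require Import structures.
From mathcomp Require Import all_boot all_order all_algebra.
From mathcomp Require Import all_classical all_reals all_analysis.
Set Implicit Arguments.
Unset Strict Implicit.
Unset Printing Implicit Defensive.
Import Order.TTheory GRing.Theory Num.Theory.
Import numFieldNormedType.Exports.
Local Open Scope ring_scope.

(* A simple graph on the vertex set V is given by its adjacency relation
   e : rel V, required to be symmetric and irreflexive in [ndl_graph]. *)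

Definition adjacency_mx (R : realType) (V : finType) (e : rel V) :
    'M[R]_#|V| :=
  \matrix_(i, j) (e (enum_val i) (enum_val j))%:R.

(* s lists the eigenvalues, with multiplicity, in nonincreasing order; this
   determines s. *)
Definition adjacency_eigenvalues (R : realType) (V : finType) (e : rel V)
    (s : seq R) : Prop :=
  sorted >=%R s /\ char_poly (adjacency_mx R e) = \prod_(a <- s) ('X - a%:P).

(* lambda_i is s`_(i-1). *)
Definition ndl_graph (R : realType) (n d : nat) (lam : R) (V : finType)
    (e : rel V) : Prop :=
  [/\ symmetric e, irreflexive e, #|V| = n,
      forall v : V, #|[set u : V | e v u]| = d
    & exists2 s : seq R, adjacency_eigenvalues e s
        & s`_0 = d%:R /\ lam = Num.max `|s`_1| `|s`_n.-1| ].

Definition induced (V : finType) (e : rel V) (S : {set V}) : rel V :=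
  [rel u v | [&& u \in S, v \in S & e u v]].

Definition components (V : finType) (e : rel V) (S : {set V}) :
    {set {set V}} :=
  [set [set v | connect (induced e S) u v] | u in S].

Definition largest_component (V : finType) (e : rel V) (S C : {set V}) :
    bool :=
  (C \in components e S) &&
  [forall C' in components e S, (#|C'| <= #|C|)%N].

Definition nb_edges (V : finType) (e : rel V) (C : {set V}) : nat :=
  #|[set [set u; v] | u in C, v in C & e u v]|.

(* The law of the random set V_p: each vertex belongs to it independently with
   probability p. *)
Definition random_subset_prob (R : realType) (V : finType) (p : R)
    (E : pred {set V}) : R :=
  \sum_(S : {set V} | E S) (\prod_(v in S) p) * (\prod_(v in ~: S) (1 - p)).

(* The number of edges of the largest component of G[S] is within err of c.
   No tie-breaking rule is chosen: the bound must hold for every component with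
   the maximum number of vertices, and there must be one (S nonempty). *)
Definition edges_L1_within (R : realType) (V : finType) (e : rel V)
    (c err : R) : pred {set V} :=
  fun S => [exists C, largest_component e S C] &&
    [forall C, largest_component e S C ==>
                 (`| (nb_edges e C)%:R - c | <= err)].

(* Main.v *)
Require Import Defs.
From HB Require Import structures.
From mathcomp Require Import all_boot all_order all_algebra.
From mathcomp Require Import all_classical all_reals all_analysis.
From mathcomp Require Import complex ring lra zify.
From mathcomp Require Import fintype finset.
Set Implicit Arguments.
Unset Strict Implicit.
Unset Printing Implicit Defensive.
Import Order.TTheory GRing.Theory Num.Theory.
Import numFieldNormedType.Exports.
Local Open Scope ring_scope.

(** Reveal G[V_p] by an adaptive exploration: at each step query an unqueried
    neighbour of the active vertices found so far, or any unqueried vertex if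
    there is none (a "restart").  After t queries let Q be the queried set and
    K its active part.

    By the spectral gap, all but few vertices have about d t / n neighbours in
    Q, whatever the order of the queries, and
    [sum over u not adjacent to K of (1 - p)^(- #neighbours of u in Q)] is a
    martingale; hence K has about n (1 - exp (- (1 + eps) t / n)) neighbours,
    for all t simultaneously by the maximal inequality.  A restart needs all
    neighbours of K to be queried, so there is none for t / n between 0 and
    the fixed point s of s = 1 - exp (- (1 + eps) s), up to small errors, and
    the vertices found in between form the giant.  Every vertex queried
    between two consecutive restarts is a new neighbour of K, so past s the
    slope < 1 of the function makes the other components small.

    At a restart all d |K| edges leaving K end in Q.  Subtracting those whose
    endpoint in K was queried last, about p e(Q), leaves the number of pairs
    (queried vertex, earlier active neighbour), and a fraction p of these are
    the edges inside K.  With |K| = p t and e(Q) = d t^2 / (2 n) this is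
    ((1 + eps)^2 / 2) (2 t / n - (t / n)^2) n / d, which at t / n = s is the
    claimed value. *)

(** * Spectral bound on degree deviations *)

Lemma char_poly_invmx_conj (F : fieldType) (m : nat) (P D : 'M[F]_m) :
  P \in unitmx -> char_poly (invmx P *m D *m P) = char_poly D.
Proof.
move=> Pu; rewrite /char_poly /char_poly_mx.
have P'u : map_mx (@polyC F) P \in unitmx by rewrite map_unitmx.
rewrite !map_mxM map_invmx.
set Q := map_mx _ P; set E := map_mx _ D.
have -> : 'X%:M - invmx Q *m E *m Q = invmx Q *m ('X%:M - E) *m Q.
  rewrite mulmxBr mulmxBl; congr (_ - _).
  by rewrite scalar_mxC -mulmxA mulVmx // mulmx1.
rewrite !det_mulmx mulrC mulrA det_inv mulrV ?mul1r //.
Qed.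

(** Since [mu] exceeds in modulus every other root, it is a simple eigenvalue, so in a unitary
    eigenbasis [u] has a single nonzero coordinate. A vector orthogonal to [u] vanishes there, and
    [A] scales its remaining coordinates by at most [lam]. *)
Lemma hermitian_contract (C : numClosedFieldType) (m : nat) (A : 'M[C]_m)
    (mu lam : C) (s : seq C) (u f : 'rV[C]_m) :
  A \is hermsymmx -> char_poly A = \prod_(a <- mu :: s) ('X - a%:P) ->
  (forall a, a \in s -> `|a| <= lam) -> lam < `|mu| ->
  u != 0 -> u *m A = mu *: u -> \sum_i f 0 i * (u 0 i)^* = 0 ->
  \sum_i `|(f *m A) 0 i| ^+ 2 <= lam ^+ 2 * \sum_i `|f 0 i| ^+ 2.
Proof.
move=> Ah Achar Hs mugt u0 uA fu.
have /orthomx_spectralP := hermitian_normalmx Ah.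
set P := spectralmx A; set sp := spectral_diag A => Aeq.
have Pun : P \is unitarymx by exact: spectral_unitarymx.
have Pu : P \in unitmx by exact: spectral_unit.
have /prod_XsubC_eq pe : \prod_(a <- mu :: s) ('X - a%:P) =
    \prod_(a <- [seq sp 0 i | i <- enum 'I_m]) ('X - a%:P).
  rewrite -Achar Aeq char_poly_invmx_conj // char_poly_trig ?diag_mx_is_trig //.
  rewrite big_map big_enum /=; apply: eq_bigr => i _.
  by rewrite mxE eqxx mulr1n.
have dotE (a b : 'rV[C]_m) : \sum_i (a *m P) 0 i * ((b *m P) 0 i)^* =
    \sum_i a 0 i * (b 0 i)^*.
  have E (a' b' : 'rV[C]_m) : \sum_i a' 0 i * (b' 0 i)^* =
      (a' *m (map_mx Num.conj b'^T)) 0 0.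
    by rewrite mxE; apply: eq_bigr => i _; rewrite !mxE.
  rewrite !E trmx_mul map_mxM mulmxA -(mulmxA a).
  by move/unitarymxP : Pun => ->; rewrite mulmx1.
have normE (a : 'rV[C]_m) : \sum_i `|(a *m P) 0 i| ^+ 2 = \sum_i `|a 0 i| ^+ 2.
  under eq_bigr do rewrite normCK.
  by rewrite dotE; apply: eq_bigr => i _; rewrite normCK.
set g := f *m invmx P; set k := u *m invmx P.
have gE : f = g *m P by rewrite mulmxKV.
have kE : u = k *m P by rewrite mulmxKV.
have k0 : k != 0 by apply: contra u0 => /eqP k0; rewrite kE k0 mul0mx.
have kD i : k 0 i * sp 0 i = mu * k 0 i.
  have : k *m diag_mx sp = mu *: k.
    by rewrite /k scalemxAl -uA [in RHS]Aeq -!mulmxA mulmxV // mulmx1.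
  by move/rowP => /(_ i); rewrite mul_mx_diag !mxE.
have [i0 ki0] : exists i, k 0 i != 0.
  have [i ki|kz] := pickP (fun i => k 0 i != 0); first by exists i.
  case/eqP: k0; apply/rowP => i; rewrite [RHS]mxE; apply/eqP.
  by move: (kz i) => /= /negbFE.
have spi0 : sp 0 i0 = mu by apply: (mulfI ki0); rewrite kD mulrC.
(* Two indices carrying [mu] would make it a double root of the characteristic polynomial. *)
have cnt : forall i, sp 0 i = mu -> i = i0.
  move=> i spi; apply/eqP; apply: contraT => ii0.
  have : (count_mem mu (mu :: s) <= 1)%N.
    rewrite /= eqxx; suff -> : count_mem mu s = 0%N by [].
    by apply/count_memPn; apply/negP => /Hs; rewrite (lt_geF mugt).
  have := permP pe (pred1 mu); rewrite /= => ->.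
  rewrite leqNgt count_map => /negP[].
  have -> : count (preim (fun i1 => sp 0 i1) (pred1 mu)) (enum 'I_m) =
     #|[set j | sp 0 j == mu]|.
    rewrite -sum1_count big_enum_cond -sum1_card.
    by apply: eq_bigl => j; rewrite !inE.
  apply: (@leq_trans #|[set i; i0]|); first by rewrite cards2 ii0.
  by apply: subset_leq_card; apply/fintype.subsetP => j;
     rewrite !inE => /orP[]/eqP ->; rewrite ?spi ?spi0.
have kz i : i != i0 -> k 0 i = 0.
  move=> ii0; apply/eqP; apply: contraNT ii0 => ki.
  by apply/eqP/cnt; apply: (mulfI ki); rewrite kD mulrC.
have gi0 : g 0 i0 = 0.
  have : \sum_i g 0 i * (k 0 i)^* = 0 by rewrite -dotE -gE -kE.
  rewrite (bigD1 i0) //= big1 ?addr0; last first.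
    by move=> i /kz ->; rewrite conjC0 mulr0.
  by move/eqP; rewrite mulf_eq0 conjC_eq0 (negPf ki0) orbF => /eqP.
have -> : f *m A = (g *m diag_mx sp) *m P by rewrite Aeq /g !mulmxA.
rewrite normE [in leRHS]gE normE mulr_sumr; apply: ler_sum => i _.
rewrite mul_mx_diag mxE normrM exprMn mulrC.
have [->|ii0] := eqVneq i i0.
  by rewrite gi0 normr0 expr0n /= !mulr0.
apply: ler_wpM2r; first by rewrite exprn_ge0.
have : sp 0 i \in mu :: s.
  by rewrite (perm_mem pe); apply/mapP; exists i => //; rewrite mem_enum.
rewrite inE => /orP[/eqP /cnt e|/Hs Hi]; first by rewrite e eqxx in ii0.
by rewrite lerXn2r // ?nnegrE ?(le_trans _ Hi).
Qed.

Section Variance.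
Context (R : realType) (n d : nat) (lam : R) (V : finType) (e : rel V).
Hypothesis Ge : ndl_graph n d lam e.
Hypothesis lam_lt : lam < d%:R.

Let sum_enum_val (F : V -> R) : \sum_(i < #|V|) F (enum_val i) = \sum_v F v.
Proof. by rewrite -(big_enum_val (A := V) F). Qed.

Let sum_adj (v : V) : \sum_u (e u v)%:R = d%:R :> R.
Proof.
case: Ge => es _ _ dg _; rewrite -(dg v) -natr_sum; congr (_%:R).
rewrite -sum1_card big_mkcond /= [RHS]big_mkcond /=; apply: eq_bigr => u _.
by rewrite inE es; case: (e v u).
Qed.

Local Notation toC := (real_complex R).

(** The matrix is moved to [R[i]] to use the spectral theorem. The all-ones vector is an eigenvector
    for [d], and [f] is orthogonal to it. *)
Lemma adjacency_contract (f : 'rV[R]_#|V|) : \sum_i f 0 i = 0 ->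
  \sum_i (f *m adjacency_mx R e) 0 i ^+ 2 <= lam ^+ 2 * \sum_i f 0 i ^+ 2.
Proof.
move=> f0; case: (Ge) => es ei Vn dg [s [srt chr] [s0 lamE]].
have lam0 : 0 <= lam by rewrite lamE le_max normr_ge0.
have d0 : (0 : R) < d%:R by exact: le_lt_trans lam_lt.
have sizes : size s = n.
  by apply: succn_inj; rewrite -Vn -(size_char_poly (adjacency_mx R e)) chr
     size_prod_XsubC.
case: s => [|a0 s] in srt chr s0 lamE sizes *.
  by move: d0; rewrite -s0 ltxx.
move: s0 => /= a0d; subst a0.
(* By sortedness every eigenvalue after the first lies between the last one and the second, whose
   moduli are at most [lam]. *)
have sle : forall a, a \in s -> `|a| <= lam.
  move=> a /(nthP 0)[i ilt <-]; rewrite lamE.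
  have snth := sorted_leq_nth ge_trans ge_refl 0 srt.
  have h1 : s`_i <= s`_0 by apply: (snth 1%N i.+1); rewrite ?inE /= ?ltnS // (leq_ltn_trans _ ilt).
  have h2 : (d%:R :: s)`_n.-1 <= s`_i.
    by apply: (snth i.+1 n.-1); rewrite ?inE /= -?sizes /= ?ltnS ?leqnn.
  move: h1 h2 => /=; set x := s`_i; set y := s`_0; set z := _`_n.-1 => h1 h2.
  rewrite ler_norml; apply/andP; split.
    rewrite lerNl le_max; apply/orP; right.
    by rewrite (@le_trans _ _ (- z)) ?lerN2 // -normrN ler_norm.
  by rewrite le_max; apply/orP; left; rewrite (le_trans h1) // ler_norm.
have nC x : `|toC x| = toC `|x|.
  have [x0|x0] := lerP 0 x.
    by have xC : 0 <= toC x := etrans (lecR 0 x) x0; rewrite !ger0_norm.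
  have xC : toC x < 0 := etrans (ltcR x 0) x0.
  by rewrite !ltr0_norm // rmorphN.
pose A := adjacency_mx R e.
have Ah : map_mx toC A \is hermsymmx.
  apply/is_hermitianmxP; rewrite expr0 scale1r; apply/matrixP => i j.
  by rewrite !mxE !rmorph_nat es.
have Ac : char_poly (map_mx toC A) = \prod_(a <- toC d%:R :: map toC s) ('X - a%:P).
  rewrite -map_char_poly chr rmorph_prod !big_cons /= big_map.
  congr (_ * _); last by apply: eq_bigr => a _; rewrite map_polyXsubC.
  by rewrite map_polyXsubC.
have V0 : (0 < #|V|)%N by rewrite Vn -sizes.
pose u : 'rV[R[i]]_#|V| := const_mx 1.
have u0 : u != 0.
  by apply/eqP => /rowP /(_ (Ordinal V0)) /eqP; rewrite !mxE oner_eq0.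
have uA : u *m map_mx toC A = toC d%:R *: u.
  apply/rowP => j; rewrite !mxE mulr1.
  under eq_bigr do rewrite !mxE mul1r.
  rewrite -raddf_sum; congr toC.
  by rewrite (sum_enum_val (fun v => (e v (enum_val j))%:R)) sum_adj.
have fu : \sum_i (map_mx toC f) 0 i * (u 0 i)^* = 0.
  under eq_bigr do rewrite !mxE conjC1 mulr1.
  by rewrite -raddf_sum f0 raddf0.
have sleC a : a \in map toC s -> `|a| <= toC lam.
  by case/mapP => b /sle bl ->; rewrite nC lecR.
have muC : toC lam < `|toC d%:R| by rewrite nC ltcR ger0_norm ?ltW.
have := hermitian_contract Ah Ac sleC muC u0 uA fu.
have sqE (g : 'rV[R]_#|V|) :
    \sum_i `|(map_mx toC g) 0 i| ^+ 2 = toC (\sum_i g 0 i ^+ 2).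
  rewrite raddf_sum; apply: eq_bigr => i _ /=.
  rewrite (_ : (map_mx toC g) 0 i = toC (g 0 i)); last by rewrite mxE.
  by rewrite nC -rmorphXn /= real_normK ?num_real.
by rewrite -map_mxM !sqE -rmorphXn -rmorphM lecR.
Qed.

(** The contraction is applied to the centred indicator of [Q]: its image is the vector of degree
    deviations, and its squared norm is |Q| - |Q|^2 / n. *)
Lemma degree_variance (Q : {set V}) :
  \sum_u (#|[set w in Q | e u w]|%:R - d%:R * #|Q|%:R / n%:R) ^+ 2
    <= lam ^+ 2 * #|Q|%:R.
Proof.
case: (Ge) => es ei Vn dg _.
have [n0|n0] := posnP n.
  rewrite big1 => [|u _]; first exact: mulr_ge0 (sqr_ge0 _) (ler0n _ _).
  by have := max_card (pred1 u); rewrite card1 Vn n0.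
have nR : (0 : R) < n%:R by rewrite ltr0n.
pose f : 'rV[R]_#|V| := \row_i ((enum_val i \in Q)%:R - #|Q|%:R / n%:R).
have sQ : \sum_v (v \in Q)%:R = #|Q|%:R :> R.
  rewrite -sum1_card natr_sum [RHS]big_mkcond /=.
  by apply: eq_bigr => v _; case: (v \in Q).
have sV (c : R) : \sum_(v : V) c = n%:R * c.
  by rewrite big_const -Vn iter_addr addr0 mulr_natl.
have f0 : \sum_i f 0 i = 0.
  under eq_bigr do rewrite mxE.
  rewrite (sum_enum_val (fun v => (v \in Q)%:R - #|Q|%:R / n%:R)).
  by rewrite sumrB sQ sV mulrC divfK ?subrr // gt_eqF.
have := adjacency_contract f0.
have -> : \sum_i (f *m adjacency_mx R e) 0 i ^+ 2 =
  \sum_u (#|[set w in Q | e u w]|%:R - d%:R * #|Q|%:R / n%:R) ^+ 2.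
  rewrite -sum_enum_val; apply: eq_bigr => j _; congr (_ ^+ 2).
  rewrite mxE; under eq_bigr do rewrite !mxE.
  rewrite (sum_enum_val (fun v => ((v \in Q)%:R - #|Q|%:R / n%:R) *
     (e v (enum_val j))%:R)).
  under eq_bigr do rewrite mulrBl.
  rewrite sumrB -mulr_sumr sum_adj; congr (_ - _); last by rewrite mulrC mulrA.
  rewrite -sum1_card natr_sum [RHS]big_mkcond /=; apply: eq_bigr => v _.
  by rewrite inE es; case: (v \in Q); case: (e _ v); rewrite /= ?mul1r ?mulr0 ?mul0r.
move=> H; apply: (le_trans H); apply: ler_wpM2l; first exact: sqr_ge0.
under eq_bigr do rewrite mxE.
rewrite (sum_enum_val (fun v => ((v \in Q)%:R - #|Q|%:R / n%:R) ^+ 2)).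
have -> : \sum_v ((v \in Q)%:R - #|Q|%:R / n%:R) ^+ 2 =
   \sum_v ((1 - 2 * (#|Q|%:R / n%:R)) * (v \in Q)%:R + (#|Q|%:R / n%:R) ^+ 2) :> R.
  by apply: eq_bigr => v _; case: (v \in Q); rewrite /=; ring.
rewrite big_split /= -mulr_sumr sQ sV; set q : R := #|Q|%:R.
have -> : (1 - 2 * (q / n%:R)) * q + n%:R * (q / n%:R) ^+ 2 = q - q ^+ 2 / n%:R.
  by field; rewrite gt_eqF.
by rewrite lerBlDr lerDl divr_ge0 ?sqr_ge0 // ltW.
Qed.

End Variance.

(** * Random subsets and adaptive exploration *)

(** From exp (-y) >= 1 - y one gets exp y <= 1 / (1 - y), and (1 + y + 2 y^2) (1 - y) = 1 + y^2 (1 -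
    2 y) >= 1. *)
Lemma expR_le_quad (R : realType) (y : R) : y <= 1 / 2 ->
  expR y <= 1 + y + 2 * y ^+ 2.
Proof.
move=> y2.
have h : expR y * (1 - y) <= 1.
  rewrite -[leRHS](mulfV (lt0r_neq0 (expR_gt0 y))) ler_pM2l ?expR_gt0 //.
  by rewrite -expRN (le_trans _ (expR_ge1Dx _)).
have y1 : 0 < 1 - y by lra.
rewrite -(ler_pM2r y1) (le_trans h) //.
have : 0 <= y ^+ 2 * (1 - 2 * y) by rewrite mulr_ge0 ?sqr_ge0 //; lra.
nra.
Qed.

(** The factor [p] in the exponent reflects the variance of a Bernoulli variable. It matters because
    [p] is of order 1 / d, so that n queries have total variance of order n / d only. *)
Lemma bernoulli_centered_mgf (R : realType) (p y : R) : 0 <= p <= 1 -> y <= 1 / 2 ->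
  p * expR (y * (1 - p)) + (1 - p) * expR (- (y * p)) <= expR (2 * p * y ^+ 2).
Proof.
move=> /andP[p0 p1] y2.
have -> : p * expR (y * (1 - p)) + (1 - p) * expR (- (y * p)) =
    expR (- (y * p)) * (1 + p * (expR y - 1)).
  by rewrite mulrBr mulr1 addrC expRD addrC; ring.
apply: (@le_trans _ _ (expR (- (y * p)) * expR (p * (y + 2 * y ^+ 2)))).
  rewrite ler_pM2l ?expR_gt0 // (le_trans _ (expR_ge1Dx _)) // lerD2l.
  by rewrite ler_wpM2l // lerBlDl addrA expR_le_quad.
by rewrite -expRD le_eqVlt; apply/orP; left; apply/eqP; congr expR; ring.
Qed.

Section RandomSubset.
Context (R : realType) (V : finType) (p : R).
Hypotheses (p_gt0 : 0 < p) (p_lt1 : p < 1).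
Local Notation Pr := (random_subset_prob p).
Implicit Types (S Q K : {set V}) (E : pred {set V}).

Definition subset_weight S : R := (\prod_(v in S) p) * (\prod_(v in ~: S) (1 - p)).

Lemma subset_weight_ge0 S : 0 <= subset_weight S.
Proof. by apply: mulr_ge0; apply: prodr_ge0 => v _; move: p_gt0 p_lt1; lra. Qed.

Lemma subset_weight_setU1 S v : v \notin S ->
  (1 - p) * subset_weight (v |: S) = p * subset_weight S.
Proof.
move=> vS; rewrite /subset_weight big_setU1 //=.
have -> : ~: S = v |: ~: (v |: S).
  apply/setP => u; rewrite !inE; case: eqVneq => [->|] //=.
rewrite big_setU1; last by rewrite !inE eqxx.
by rewrite /=; ring.
Qed.

(** The probability that revealing the vertices of [Q] shows exactly those of [K] to be active. *)
Definition cond_weight Q K : R := \sum_(S | S :&: Q == K) subset_weight S.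

Lemma sum_setI_split Q K v (F : {set V} -> R) (E : pred {set V}) :
  v \notin Q -> K \subset Q ->
  \sum_(S | (S :&: Q == K) && E S) F S =
  \sum_(S | (S :&: (v |: Q) == v |: K) && E S) F S +
  \sum_(S | (S :&: (v |: Q) == K) && E S) F S.
Proof.
move=> vQ KQ; rewrite (bigID (fun S => v \in S)) /=.
have vK : v \notin K by apply: contra vQ; exact: (subsetP KQ).
congr (_ + _); apply: eq_bigl => S; rewrite -andbA [E S && _]andbC andbA;
  congr (_ && _); rewrite setIUr.
  have [vS|vS] := boolP (v \in S); last first.
    rewrite andbF; apply/esym/eqP => /setP /(_ v).
    by rewrite !inE (negPf vS) eqxx.
  rewrite andbT (_ : S :&: [set v] = [set v]); last first.
    by apply/setP => u; rewrite !inE; case: eqVneq => [->|]; rewrite ?vS ?andbF.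
  apply/eqP/eqP => [->//|/setP H]; apply/setP => u.
  have := H u; rewrite !inE; case: eqVneq => [->|] //=.
  by rewrite (negPf vQ) (negPf vK) andbF.
have [vS|vS] := boolP (v \in S).
  rewrite andbF; apply/esym/eqP => /setP /(_ v).
  by rewrite !inE vS eqxx (negPf vK).
rewrite andbT (_ : S :&: [set v] = set0) ?set0U //.
by apply/setP => u; rewrite !inE; case: eqVneq => [->|]; rewrite ?(negPf vS) ?andbF.
Qed.

(** Inserting [v] is a bijection between the sets of the two events and multiplies weights by p / (1
    - p). This ratio and the sum of the two weights determine both. *)
Lemma cond_weight_setU1 Q K v : v \notin Q -> K \subset Q ->
  cond_weight (v |: Q) (v |: K) = p * cond_weight Q K /\
  cond_weight (v |: Q) K = (1 - p) * cond_weight Q K.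
Proof.
move=> vQ KQ.
have vK : v \notin K by apply: contra vQ; exact: (subsetP KQ).
have H : (1 - p) * cond_weight (v |: Q) (v |: K) = p * cond_weight (v |: Q) K.
  rewrite /cond_weight !mulr_sumr.
  rewrite (reindex_onto (fun S => v |: S) (fun S => S :\ v)) /=; last first.
    move=> S /eqP /setP /(_ v); rewrite !inE eqxx /= andbT => vS.
    by rewrite setD1K.
  have E S : ((v |: S) :&: (v |: Q) == v |: K) && ((v |: S) :\ v == S) =
     (S :&: (v |: Q) == K).
    apply/andP/eqP => [[/eqP /setP A /eqP /setP B]|SK].
      apply/setP => u; have := A u; have := B u; rewrite !inE.
      case: eqVneq => [->|uv] /=; first by rewrite (negPf vK) => <-.
      by [].
    have vS : v \notin S.
      by move/setP : SK => /(_ v); rewrite !inE eqxx andbT (negPf vK) => ->.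
    split; last by rewrite setU1K.
    rewrite -SK; apply/eqP/setP => u; rewrite !inE.
    by case: eqVneq.
  rewrite (eq_bigl _ _ E); apply: eq_bigr => S /eqP /setP /(_ v).
  rewrite !inE eqxx andbT (negPf vK) => /negbT vS.
  by rewrite subset_weight_setU1.
have T := sum_setI_split subset_weight xpredT vQ KQ.
move: T; under eq_bigl do rewrite andbT.
under [X in _ = X + _ -> _]eq_bigl do rewrite andbT.
under [X in _ = _ + X -> _]eq_bigl do rewrite andbT.
rewrite -!/(cond_weight _ _) => T.
by rewrite T; split; nra.
Qed.

Lemma sum_subset_prod (f g : V -> R) :
  \sum_(S : {set V}) (\prod_(v in S) f v) * (\prod_(v in ~: S) g v) = \prod_v (f v + g v).
Proof.
rewrite bigA_distr; apply: eq_bigr => S _.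
rewrite [RHS](bigID (fun v => v \in S)) /=; congr (_ * _).
  by apply: eq_bigr => v ->.
by apply: eq_big => v; rewrite ?inE // => /negPf ->.
Qed.

Lemma cond_weight0 : cond_weight set0 set0 = 1.
Proof.
rewrite /cond_weight; under eq_bigl do rewrite setI0 eqxx.
rewrite sum_subset_prod big1 // => v _; ring.
Qed.

Lemma cond_weight_ge0 Q K : 0 <= cond_weight Q K.
Proof. by apply: sumr_ge0 => S _; exact: subset_weight_ge0. Qed.

Lemma prob_subadd E1 E2 : Pr (fun S => E1 S || E2 S) <= Pr E1 + Pr E2.
Proof.
rewrite /random_subset_prob [in leRHS]big_mkcond /= [X in _ <= _ + X]big_mkcond /=.
rewrite big_mkcond -big_split /=; apply: ler_sum => S _.
have := subset_weight_ge0 S; rewrite /subset_weight.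
by case: (E1 S); case: (E2 S) => /=; lra.
Qed.

Lemma prob_le E1 E2 : (forall S, E1 S -> E2 S) -> Pr E1 <= Pr E2.
Proof.
move=> H; rewrite /random_subset_prob big_mkcond [leRHS]big_mkcond.
apply: ler_sum => S _; have := subset_weight_ge0 S; rewrite /subset_weight.
by case: (boolP (E1 S)) => [/H ->|] //; case: ifP.
Qed.

Lemma prob_predC E : Pr E = 1 - Pr (fun S => ~~ E S).
Proof.
apply/eqP; rewrite eq_sym subr_eq -cond_weight0 /cond_weight.
under eq_bigl do rewrite setI0 eqxx.
by rewrite (bigID E).
Qed.

Lemma prob_markov (F : {set V} -> R) (c : R) : 0 < c -> (forall S, 0 <= F S) ->
  Pr (fun S => c <= F S) <= (\sum_(S : {set V}) subset_weight S * F S) / c.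
Proof.
move=> c0 F0; rewrite ler_pdivlMr // mulr_suml [leLHS]big_mkcond.
apply: ler_sum => S _; case: ifP => cF; last by rewrite mulr_ge0 ?subset_weight_ge0.
by apply: ler_wpM2l => //; exact: subset_weight_ge0.
Qed.

Section Exploration.
Variable nxt : {set V} -> {set V} -> V.
Hypothesis nxtP : forall Q K, Q != setT -> nxt Q K \notin Q.

(** The choice of the next vertex sees [S] only through [Q :&: S], which makes the exploration
    adaptive without reading the future. *)
Definition query S Q : {set V} := nxt Q (Q :&: S) |: Q.
Definition queried S i : {set V} := iter i (query S) set0.
Definition asked S i : V := nxt (queried S i) (queried S i :&: S).

(** A martingale difference: the coefficient [a] depends on the past alone, and the status of the
    next vertex is centred. *)
Definition incr (a : {set V} -> {set V} -> R) S Q : R :=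
  a Q (Q :&: S) * ((nxt Q (Q :&: S) \in S)%:R - p).

Let acc a S Q m := \sum_(i < m) incr a S (iter i (query S) Q).

(* Doob's maximal inequality for the exponential supermartingale, by induction
   on the number of queries left, over all possible partial explorations. *)
Lemma exp_maximal (a : {set V} -> {set V} -> R) (th c : R) :
  (forall Q K, th * a Q K <= 1 / 2) ->
  (forall Q K, 2 * p * (th * a Q K) ^+ 2 <= c) ->
  forall m Q K (L : R), K \subset Q -> (m + #|Q| <= #|V|)%N ->
  \sum_(S | (S :&: Q == K) && [exists i : 'I_m.+1, L <= th * acc a S Q i - c * i%:R])
     subset_weight S <= cond_weight Q K * expR (- L).
Proof.
move=> ha hc; elim=> [|m IH] Q K L KQ mQ.
(* For [L <= 0] the factor [expR (- L)] is at least 1. For [L > 0] the index i = 0 cannot be a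
   witness, which settles the case without queries and lets the induction drop the first query. *)
all: have [L0|L0] := lerP L 0; first (apply: (@le_trans _ _ (cond_weight Q K));
    [rewrite /cond_weight big_mkcondr; apply: ler_sum => S _; case: ifP => // _;
     exact: subset_weight_ge0
    | rewrite ler_peMr ?cond_weight_ge0 // (le_trans _ (expR_ge1Dx _)) //; lra]).
  rewrite big_pred0 ?mulr_ge0 ?cond_weight_ge0 ?expR_ge0 // => S.
  apply/negP => /andP[_ H]; case/existsP: H => i.
  by rewrite ord1 /acc big_ord0 /=; lra.
have QT : Q != setT.
  apply/eqP => QT; move: mQ; rewrite QT cardsT; lia.
set v := nxt Q K; have vQ : v \notin Q by exact: nxtP.
have mvQ : (m + #|v |: Q| <= #|V|)%N by rewrite cardsU1 vQ; lia.
set A := a Q K.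
have accS S i : S :&: Q = K ->
    acc a S Q i.+1 = A * ((v \in S)%:R - p) + acc a S (v |: Q) i.
  move=> SQ; rewrite /acc big_ord_recl.
  congr (_ + _); first by rewrite /incr /= setIC SQ.
  apply: eq_bigr => j _; rewrite (_ : nat_of_ord (lift ord0 j) = j.+1) // iterSr.
  by rewrite {2}/query [Q :&: S]setIC SQ.
have hit S b : S :&: Q = K -> (v \in S)%:R = b ->
    [exists i : 'I_m.+2, L <= th * acc a S Q i - c * i%:R] ->
    [exists i : 'I_m.+1, L - th * A * (b - p) + c <= th * acc a S (v |: Q) i - c * i%:R].
  move=> SQ vb H; case/existsP: H => -[[|i] ilt] /= H.
    by move: H; rewrite /acc big_ord0; lra.
  apply/existsP; exists (Ordinal (ilt : i < m.+1)%N) => /=.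
  by move: H; rewrite accS // vb -natr1; lra.
have [W1 W0] := cond_weight_setU1 vQ KQ.
have vK : v \notin K by apply: contra vQ; exact: (subsetP KQ).
rewrite (sum_setI_split _ _ vQ KQ).
(* The levels still to be reached after the first query, according to whether [v] is active or
   not. *)
pose L1 := L - th * A * (1 - p) + c; pose L2 := L - th * A * (0 - p) + c.
have B1 := IH (v |: Q) (v |: K) L1 (setUS _ KQ) mvQ.
have B2 := IH (v |: Q) K L2 (subset_trans KQ (subsetUr _ _)) mvQ.
have SQ S K' : S :&: (v |: Q) = K' -> K' :&: Q = K -> S :&: Q = K.
  by move=> <- <-; rewrite -setIA (setIidPr (subsetUr _ _)).
apply: (@le_trans _ _ (cond_weight (v |: Q) (v |: K) * expR (- L1) +
                       cond_weight (v |: Q) K * expR (- L2))).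
  apply: lerD; [apply: le_trans B1 | apply: le_trans B2];
  rewrite big_mkcond [leRHS]big_mkcond; apply: ler_sum => S _;
  case: (boolP (_ == _)) => //= /eqP SE; case: ifP => [H|_];
  try by case: ifP => // _; exact: subset_weight_ge0.
    rewrite (@hit S 1 _ _ H) //.
      by apply: SQ SE _; rewrite setIUl (setIidPl KQ)
           (_ : [set v] :&: Q = set0) ?set0U //;
         apply/setP => u; rewrite !inE; case: eqVneq => [->|] //=; rewrite (negPf vQ).
    by move/setP : SE => /(_ v); rewrite !inE eqxx andbT => ->.
  rewrite (@hit S 0 _ _ H) //; first by apply: SQ SE _; rewrite (setIidPl KQ).
  by move/setP : SE => /(_ v); rewrite !inE eqxx andbT (negPf vK) => ->.
rewrite W1 W0.
have -> : - L1 = - L - c + th * A * (1 - p) by rewrite /L1; ring.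
have -> : - L2 = - L - c + - (th * A * p) by rewrite /L2; ring.
rewrite ![expR (_ - c + _)]expRD.
have -> : p * cond_weight Q K * (expR (- L - c) * expR (th * A * (1 - p))) +
   (1 - p) * cond_weight Q K * (expR (- L - c) * expR (- (th * A * p))) =
   cond_weight Q K * (expR (- L - c) *
     (p * expR (th * A * (1 - p)) + (1 - p) * expR (- (th * A * p)))).
  by ring.
apply: ler_wpM2l; first exact: cond_weight_ge0.
(* The compensator [c] paid at this query absorbs the moment generating function of the
   increment. *)
apply: (@le_trans _ _ (expR (- L - c) * expR c)).
  apply: ler_wpM2l; first exact: expR_ge0.
  apply: (le_trans (bernoulli_centered_mgf _ (ha Q K))); first by rewrite !ltW.
  by rewrite ler_expR hc.
by rewrite -expRD subrK.
Qed.

(** The exponential bound is used for [a] and for its opposite, over the whole exploration; [r]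
    measures the expected number of active vertices. *)
Lemma maximal_tail (a : {set V} -> {set V} -> R) (A r del : R) :
  0 < A -> 0 < r -> p * #|V|%:R <= 2 * r -> 0 < del <= 4 ->
  (forall Q K, `|a Q K| <= A) ->
  Pr (fun S => [exists i : 'I_#|V|.+1,
        del * r * A <= `|\sum_(j < i) incr a S (queried S j)|])
  <= 2 * expR (- (del ^+ 2 * r / 16)).
Proof.
move=> A0 r0 pV /andP[del0 del4] aA.
have A0' : A != 0 by rewrite gt_eqF.
have one (b : {set V} -> {set V} -> R) : (forall Q K, `|b Q K| <= A) ->
  Pr (fun S => [exists i : 'I_#|V|.+1,
        del * r * A <= \sum_(j < i) incr b S (queried S j)])
  <= expR (- (del ^+ 2 * r / 16)).
  (* With this [th] the level is worth del^2 r / 8, while the compensators of all queries add up to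
     at most half of that. *)
  move=> bA; pose th := del / (8 * A); pose c := 2 * p * (th * A) ^+ 2.
  have thA : th * A = del / 8 by rewrite /th; field.
  have th0 : 0 < th by rewrite /th divr_gt0 ?mulr_gt0.
  have tb Q K : `|th * b Q K| <= th * A.
    by rewrite normrM (gtr0_norm th0) ler_pM2l.
  have h1 Q K : th * b Q K <= 1 / 2.
    by rewrite (le_trans (ler_norm _)) // (le_trans (tb Q K)) // thA; lra.
  have h2 Q K : 2 * p * (th * b Q K) ^+ 2 <= c.
    apply: ler_wpM2l; first by rewrite mulr_ge0 // ltW.
    by rewrite -real_normK ?num_real // lerXn2r ?nnegrE // (le_trans _ (tb Q K)).
  pose L := del ^+ 2 * r / 16.
  have sV : (#|V| + #|@set0 V| <= #|V|)%N by rewrite cards0 addn0.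
  have := exp_maximal h1 h2 L (sub0set set0) sV.
  rewrite cond_weight0 mul1r; apply: le_trans.
  apply: prob_le => S H; rewrite setI0 eqxx /=.
  case/existsP: H => i Hi; apply/existsP; exists i.
  move: Hi; set X := \sum_(_ < _) _ => Hi.
  change (L <= th * X - c * i%:R).
  have iV : (i%:R : R) <= #|V|%:R by rewrite ler_nat -ltnS.
  have H1 : del ^+ 2 * r / 8 <= th * X.
    have -> : del ^+ 2 * r / 8 = th * (del * r * A) by rewrite /th; field.
    by rewrite ler_pM2l.
  have H2 : c * i%:R <= del ^+ 2 * r / 16.
    apply: (@le_trans _ _ (c * #|V|%:R)).
      by rewrite ler_wpM2l // /c mulr_ge0 ?sqr_ge0 // mulr_ge0 // ltW.
    have -> : c * #|V|%:R = 2 * (th * A) ^+ 2 * (p * #|V|%:R) by rewrite /c; ring.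
    have -> : del ^+ 2 * r / 16 = 2 * (th * A) ^+ 2 * (2 * r) by rewrite thA; field.
    by rewrite ler_wpM2l // mulr_ge0 ?sqr_ge0.
  by move: H1 H2; rewrite /L; set Y := del ^+ 2 * r; lra.
have aN Q K : `|- a Q K| <= A by rewrite normrN.
have B1 := one a aA; have B2 := one (fun Q K => - a Q K) aN.
rewrite mulr_natl mulr2n; apply: le_trans (lerD B1 B2).
apply: le_trans (prob_subadd _ _); apply: prob_le => S H.
case/existsP: H => i; rewrite ler_normr => /orP[] H; apply/orP; [left|right];
  apply/existsP; exists i => //.
by rewrite (le_trans H) // -sumrN; apply: ler_sum => j _; rewrite /incr mulNr.
Qed.

End Exploration.
End RandomSubset.

(** * Exploration of a graph *)

Arguments queried : simpl never.
Arguments asked : simpl never.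

Section GraphExploration.
Context (V : finType) (e : rel V) (v0 : V).
Hypotheses (e_sym : symmetric e) (e_irr : irreflexive e).
Implicit Types (A B C S Q K : {set V}) (u v w : V).
Local Open Scope nat_scope.

Definition degin A v : nat := #|[set w in A | e v w]|.
(** Ordered pairs are counted, so an edge inside both sets counts twice. *)
Definition edges_between A B : nat := \sum_(v in A) degin B v.
Definition nbhd A : {set V} := [set u | 0 < degin A u].

Lemma deginE A v : degin A v = \sum_(w in A) e v w.
Proof.
rewrite /degin -sum1_card big_mkcond [RHS]big_mkcond /=; apply: eq_bigr => w _.
by rewrite inE; case: (w \in A); case: (e v w).
Qed.

Lemma nbhdP A u : reflect (exists2 w, w \in A & e u w) (u \in nbhd A).
Proof.
rewrite inE card_gt0; apply: (iffP (set0Pn _)) => -[w].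
  by rewrite inE => /andP[]; exists w.
by exists w; rewrite inE; apply/andP.
Qed.

Lemma degin_setU1 A v w : v \notin A -> degin (v |: A) w = e w v + degin A w.
Proof. by move=> vA; rewrite !deginE big_setU1. Qed.

Lemma edges_between_setU1l A B v : v \notin A ->
  edges_between (v |: A) B = degin B v + edges_between A B.
Proof. by move=> vA; rewrite /edges_between big_setU1. Qed.

Lemma edges_betweenC A B : edges_between A B = edges_between B A.
Proof.
rewrite /edges_between; under eq_bigr do rewrite deginE.
rewrite exchange_big; apply: eq_bigr => v _; rewrite deginE.
by apply: eq_bigr => w _; rewrite e_sym.
Qed.

Lemma edges_between_setU1r A B v : v \notin B ->
  edges_between A (v |: B) = degin A v + edges_between A B.
Proof. by move=> vB; rewrite !(edges_betweenC A) edges_between_setU1l. Qed.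

Lemma degin_subset A B v : A \subset B -> degin A v <= degin B v.
Proof.
move=> AB; apply: subset_leq_card; apply/subsetP => w; rewrite !inE => /andP[wA ->].
by rewrite (subsetP AB).
Qed.

Lemma nbhdS A B : A \subset B -> nbhd A \subset nbhd B.
Proof.
move=> AB; apply/subsetP => u; rewrite !inE => H.
by rewrite (leq_trans H) // degin_subset.
Qed.

(** The map from (u, v) to {u, v} on adjacent pairs has fibres of size two, because the graph has no
    loop. *)
Lemma nb_edgesE C : (nb_edges e C).*2 = edges_between C C.
Proof.
pose D := [set uv : V * V | [&& uv.1 \in C, uv.2 \in C & e uv.1 uv.2]].
pose h (uv : V * V) := [set uv.1; uv.2].
have -> : edges_between C C = \sum_(uv in D) 1.
  rewrite /edges_between; under eq_bigr do rewrite deginE.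
  rewrite pair_big_dep /= big_mkcond [RHS]big_mkcond /=; apply: eq_bigr => -[u v] _.
  by rewrite inE /=; case: (u \in C); case: (v \in C); case: (e u v).
rewrite (partition_big_imset h) /=.
have -> : nb_edges e C = #|h @: D|.
  rewrite /nb_edges; congr #|pred_of_set _|; apply/setP => X.
  apply/imset2P/imsetP => [[u v uC] | [[u v]]].
    by rewrite inE => /andP[vC euv] ->; exists (u, v) => //; rewrite inE /= uC vC.
  by rewrite inE /= => /and3P[uC vC euv] ->; exists u v => //; rewrite inE vC.
rewrite -muln2 -sum_nat_const; apply: eq_bigr => X /imsetP[[u v]].
rewrite inE /= => /and3P[uC vC euv] ->.
have uv : u != v by apply: contraTneq euv => ->; rewrite e_irr.
rewrite sum1_card.
rewrite (eq_card (B := [set (u, v); (v, u)])).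
  by rewrite cards2 xpair_eqE (negPf uv).
move=> [x y]; rewrite !inE /= !xpair_eqE unfold_in inE /=.
apply/idP/idP => [/andP[/and3P[xC yC exy] /eqP /setP H]|].
  have xy : x != y by apply: contraTneq exy => ->; rewrite e_irr.
  have := H x; have := H y; rewrite !inE !eqxx /= orbT.
  move=> /esym/orP[]/eqP yE /esym/orP[]/eqP xE; subst x y; rewrite ?eqxx ?orbT //;
    by rewrite eqxx in xy.
case/orP => /andP[/eqP -> /eqP ->]; first by rewrite uC vC euv eqxx.
by rewrite uC vC e_sym euv /h /= setUC eqxx.
Qed.

(* The value v0 is only taken when every vertex has been queried. *)
Definition bfs_next Q K : V :=
  if [pick u in nbhd K :\: Q] is Some u then u
  else if [pick u in ~: Q] is Some u then u else v0.

Lemma bfs_next_notin Q K : Q != setT -> bfs_next Q K \notin Q.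
Proof.
move=> QT; rewrite /bfs_next; case: pickP => [u|_]; first by rewrite inE => /andP[].
case: pickP => [u|H]; first by rewrite inE.
case/eqP: QT; apply/setP => u; rewrite [RHS]inE.
by have := H u; rewrite /= in_setC => /negbFE.
Qed.

Lemma bfs_next_nbhd Q K : ~~ (nbhd K \subset Q) -> bfs_next Q K \in nbhd K.
Proof.
case/subsetPn => u uK uQ; rewrite /bfs_next; case: pickP => [w|/(_ u)].
  by rewrite inE => /andP[].
by rewrite inE uK uQ.
Qed.

Local Notation qd := (queried bfs_next).
Definition active S i := qd S i :&: S.
(** At such a time the active set is a union of components of G[S]. Times 0 and [#|V|] qualify. *)
Definition restart S i := nbhd (active S i) \subset qd S i.
Local Notation vx := (asked bfs_next).

Lemma queriedS S i : qd S i.+1 = vx S i |: qd S i.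
Proof. by []. Qed.

Lemma card_queried S i : i <= #|V| -> #|qd S i| = i.
Proof.
elim: i => [|i IH] iV; first by rewrite cards0.
have IHi := IH (ltnW iV); rewrite queriedS cardsU1 IHi bfs_next_notin //.
by apply: contraTneq iV => E; rewrite -leqNgt -IHi E cardsT.
Qed.

Lemma asked_notin S i : i < #|V| -> vx S i \notin qd S i.
Proof.
move=> iV; apply: bfs_next_notin; apply: contraTneq iV => E.
rewrite -leqNgt; case: (leqP i #|V|) => [iV|/ltnW //].
by rewrite -(card_queried S iV) E cardsT.
Qed.

Lemma queried_all S : qd S #|V| = setT.
Proof.
apply/eqP; rewrite eqEcard subsetT /= cardsT.
by rewrite (card_queried S (leqnn _)) leqnn.
Qed.

Lemma queried_subset S i j : i <= j -> qd S i \subset qd S j.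
Proof.
elim: j => [|j IH]; first by rewrite leqn0 => /eqP ->.
rewrite leq_eqVlt => /orP[/eqP -> //|]; rewrite ltnS => /IH H.
by rewrite (subset_trans H) // queriedS subsetUr.
Qed.

Lemma active_subset S i j : i <= j -> active S i \subset active S j.
Proof. by move=> ij; apply: setSI; exact: queried_subset. Qed.

Lemma activeS S i : active S i.+1 = if vx S i \in S then vx S i |: active S i else active S i.
Proof.
rewrite /active queriedS setIUl; case: ifP => vS.
  by rewrite (setIidPl _) // sub1set.
rewrite (_ : [set vx S i] :&: S = set0) ?set0U //.
by apply/setP => u; rewrite !inE; case: eqVneq => [->|] //=; rewrite ?vS.
Qed.

Lemma active_notin S i : i < #|V| -> vx S i \notin active S i.
Proof. by move=> /(asked_notin S) H; rewrite inE (negPf H). Qed.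

Lemma restart0 S : restart S 0.
Proof.
apply/subsetP => u /nbhdP[w]; by rewrite inE in_set0.
Qed.

Lemma restart_all S : restart S #|V|.
Proof. by rewrite /restart queried_all subsetT. Qed.

Lemma restart_notin S i w : restart S i -> w \in active S i ->
  forall u, e u w -> u \in qd S i.
Proof. by move=> /subsetP H wA u uw; apply: H; apply/nbhdP; exists w. Qed.

Lemma restart_interval S t : t < #|V| -> exists a b : nat,
  [/\ a <= t < b, b <= #|V|, restart S a, restart S b
    & forall i, a < i < b -> ~~ restart S i].
Proof.
move=> tV.
pose P i := restart S i && (i <= t); pose P' i := restart S i && (t < i).
have exP : exists i, P i by exists 0; rewrite /P restart0.
have ubP i : P i -> i <= t by case/andP.
have exP' : exists i, P' i by exists #|V|; rewrite /P' restart_all.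
case: (ex_maxnP exP ubP) => a /andP[ra at_] amax.
case: (ex_minnP exP') => b /andP[rb tb] bmin.
exists a, b; split=> //; first by rewrite at_ tb.
  by apply: bmin; rewrite /P' restart_all.
move=> i /andP[ai ib]; apply/negP => ri.
have [it|ti] := leqP i t.
  by have := amax i; rewrite /P ri it => /(_ isT); lia.
by have := bmin i; rewrite /P' ri ti => /(_ isT); lia.
Qed.

(** * Components as intervals between consecutive restarts *)

Section Interval.
Variables (S : {set V}) (a b : nat).
Hypotheses (ab : a < b) (bV : b <= #|V|) (ra : restart S a) (rb : restart S b)
  (rab : forall i, a < i < b -> ~~ restart S i).

Let L := active S b :\: active S a.

Lemma interval_asked i : a < i < b -> vx S i \in nbhd (active S i).
Proof. by move=> iab; apply: bfs_next_nbhd; exact: rab. Qed.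

Lemma interval_closed x y : x \in L -> y \in S -> e x y -> y \in L.
Proof.
rewrite inE => /andP[xa xb] yS exy.
have yb : y \in active S b.
  by rewrite inE yS andbT; apply: (restart_notin rb xb); rewrite e_sym.
rewrite inE yb andbT; apply: contra xa => ya.
rewrite inE (restart_notin ra ya exy) /=.
by move: xb; rewrite inE => /andP[].
Qed.

(** A vertex queried strictly between the restarts has an active neighbour. That neighbour was not
    active at time [a], since otherwise the vertex would already have been queried then, so the
    induction hypothesis links it to the first query [vx S a]. *)
Lemma interval_connect i : a < i <= b ->
  forall x, x \in active S i :\: active S a -> connect (Defs.induced e S) (vx S a) x.
Proof.
elim: i => [|i IH] //; rewrite ltnS => /andP[ai ib] x.
rewrite activeS; move: ai; rewrite leq_eqVlt => /orP[/eqP <-|ai].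
  case: ifP => vS; last by rewrite setDv inE.
  by rewrite !inE => /andP[xa /orP[/eqP ->|]] //; rewrite (negPf xa).
have IHi := IH (introT andP (conj ai (ltnW ib))).
case: ifP => vS; last exact: IHi.
rewrite inE => /andP[xa]; rewrite in_setU1 => /orP[/eqP xv|xi]; last first.
  by apply: IHi; rewrite inE xa.
have /nbhdP[y yi xy] := interval_asked (introT andP (conj ai ib)).
have ya : y \notin active S a.
  apply/negP => /(restart_notin ra) /(_ _ xy) va.
  have := asked_notin S (leq_trans ib bV).
  by rewrite (subsetP (queried_subset S (ltnW ai))).
have cy : connect (Defs.induced e S) (vx S a) y by apply: IHi; rewrite inE ya.
apply: (connect_trans cy); apply: connect1; apply/and3P.
by rewrite xv e_sym; split=> //; move: yi; rewrite inE => /andP[].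
Qed.

(** Closedness of [L] gives one inclusion, connection through the first query the other. *)
Lemma interval_component u : u \in L ->
  [set v | connect (Defs.induced e S) u v] = L.
Proof.
have isym : connect_sym (Defs.induced e S).
  by apply: sym_connect_sym => x y; rewrite /Defs.induced /= e_sym; case: (x \in S); case: (y \in S).
have cl : fingraph.closed (Defs.induced e S) (mem L).
  move=> x y /and3P[xS yS exy]; apply/idP/idP => H; first exact: interval_closed H yS exy.
  by apply: (interval_closed H xS); rewrite e_sym.
move=> uL; apply/setP => v; rewrite inE; apply/idP/idP => [c|vL].
  by rewrite -(closed_connect cl c).
have cb := @interval_connect b; rewrite ab leqnn in cb.
apply: connect_trans (cb isT v vL).
by rewrite isym; apply: cb.
Qed.

Lemma interval_mem_components : L != set0 -> L \in components e S.
Proof.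
case/set0Pn => u uL; apply/imsetP; exists u; last by rewrite interval_component.
by move: uL; rewrite !inE => /and3P[].
Qed.

(** The queries after the first are neighbours of the active set, and they are new because all
    neighbours known at the restart [a] were queried by then. The query made at [a] itself need not
    be a neighbour, hence [a.+1]. *)
Lemma interval_nbhd : #|nbhd (active S a)| + (b - a.+1) <= #|nbhd (active S b)|.
Proof.
have sub i : a < i <= b -> qd S i :\: qd S a.+1 \subset nbhd (active S i).
  elim: i => [|i IH] //; rewrite ltnS => /andP[ai ib].
  move: ai; rewrite leq_eqVlt => /orP[/eqP <-|ai]; first by rewrite setDv sub0set.
  apply/subsetP => x; rewrite in_setD => /andP[xa].
  rewrite queriedS in_setU1 => /orP[/eqP ->|xi].
    apply: (subsetP (nbhdS (active_subset S (leqnSn i)))).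
    by apply: interval_asked; rewrite ai.
  apply: (subsetP (nbhdS (active_subset S (leqnSn i)))).
  by apply: (subsetP (IH _)); rewrite ?ai ?(ltnW ib) // inE xa.
rewrite -[X in _ + (X - _)](card_queried S bV).
rewrite -[X in _ + (_ - X)](card_queried S (leq_trans ab bV)).
rewrite -cardsDS ?queried_subset //.
rewrite -cardsUI (_ : _ :&: _ = set0) ?cards0 ?addn0; last first.
  apply/setP => x; rewrite [RHS]inE; apply/negP => /setIP[/(subsetP ra) xa].
  by rewrite inE (subsetP (queried_subset S (leqnSn a))).
apply: subset_leq_card; rewrite subUset nbhdS ?active_subset ?(ltnW ab) //=.
by apply: sub; rewrite ab leqnn.
Qed.

(** No edge joins [L] to the vertices active at time [a]. *)
Lemma interval_edges : edges_between (active S b) (active S b) =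
  edges_between L L + edges_between (active S a) (active S a).
Proof.
have sab := active_subset S (ltnW ab).
rewrite /edges_between (big_setID (active S a)) /= (setIidPr sab) addnC.
congr (_ + _); apply: eq_bigr => v vL; congr #|pred_of_set _|; apply/setP => w;
  rewrite [LHS]in_set [RHS]in_set; apply: andb_id2r => vw.
  have [wb|wb] := boolP (w \in active S b); last first.
    by rewrite in_setD (negPf wb) andbF.
  have wS : w \in S by move: wb; rewrite in_setI => /andP[].
  by rewrite (interval_closed vL wS vw).
have [wa|wa] := boolP (w \in active S a); first by rewrite (subsetP sab).
apply/negP => wb; have wL : w \in L by rewrite in_setD wa.
have vS : v \in S by move: vL; rewrite in_setI => /andP[].
have := interval_closed wL vS; rewrite e_sym => /(_ vw).
by rewrite in_setD vL.
Qed.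

End Interval.

Lemma component_interval S C : C \in components e S -> exists a b : nat,
  [/\ a < b <= #|V|, restart S a, restart S b,
      forall i, a < i < b -> ~~ restart S i & C = active S b :\: active S a].
Proof.
case/imsetP => u uS ->.
(* The time at which [u] is queried; the restarts around it delimit its component. *)
have [t tV ut] : exists2 t, t < #|V| & (u \notin qd S t) && (u \in qd S t.+1).
  have ex : exists i, u \in qd S i by exists #|V|; rewrite queried_all inE.
  case: (ex_minnP ex) => -[|t]; first by rewrite in_set0.
  move=> ut tmin; exists t; first by apply: tmin; rewrite queried_all inE.
  by rewrite ut andbT; apply/negP => /tmin; rewrite ltnn.
have [a [b [/andP[at_ tb] bV ra rb rab]]] := restart_interval S tV.
exists a, b; rewrite (leq_ltn_trans at_ tb) bV; split=> //.
apply: (interval_component (leq_ltn_trans at_ tb) bV ra rb rab).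
case/andP: ut => ut1 ut2; rewrite !inE uS !andbT.
by rewrite (subsetP (queried_subset S tb) _ ut2) andbT;
   apply: contra ut1; exact: (subsetP (queried_subset S at_)).
Qed.

(** * Edge counts along the exploration *)

Section Sums.
Variables (S : {set V}) (t : nat).
Hypothesis tV : t <= #|V|.

Lemma sum_asked_active : \sum_(i < t) (vx S i \in S) = #|active S t|.
Proof.
elim: t tV => [|i IH] iV; first by rewrite big_ord0 /active set0I cards0.
rewrite big_ord_recr /= IH ?(ltnW iV) // activeS; case: ifP => _; last by rewrite addn0.
by rewrite cardsU1 active_notin // addnC.
Qed.

(** Each edge is charged to the endpoint queried last. *)
Lemma sum_degin_queried :
  (\sum_(i < t) degin (qd S i) (vx S i)).*2 = edges_between (qd S t) (qd S t).
Proof.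
elim: t tV => [|i IH] iV; first by rewrite big_ord0 /edges_between big_set0.
rewrite big_ord_recr /= doubleD IH ?(ltnW iV) //.
have vq := asked_notin S iV.
rewrite queriedS edges_between_setU1l // edges_between_setU1r // degin_setU1 // e_irr.
by lia.
Qed.

(** Pairs of a queried vertex and an active neighbour are split by which of the two was queried
    last: in the first term the active one came earlier, in the second it came later. *)
Lemma sum_degin_active :
  \sum_(i < t) (degin (active S i) (vx S i) + (vx S i \in S) * degin (qd S i) (vx S i))
  = edges_between (qd S t) (active S t).
Proof.
elim: t tV => [|i IH] iV; first by rewrite big_ord0 /edges_between big_set0.
rewrite big_ord_recr /= IH ?(ltnW iV) //.
have vq := asked_notin S iV; have va := active_notin S iV.
rewrite queriedS activeS edges_between_setU1l //; case: ifP => _.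
  by rewrite edges_between_setU1r // degin_setU1 // e_irr; lia.
by lia.
Qed.

Lemma sum_degin_active_active :
  (\sum_(i < t) (vx S i \in S) * degin (active S i) (vx S i)).*2
  = edges_between (active S t) (active S t).
Proof.
elim: t tV => [|i IH] iV; first by rewrite big_ord0 /active set0I /edges_between big_set0.
rewrite big_ord_recr /= doubleD IH ?(ltnW iV) //.
have va := active_notin S iV.
rewrite activeS; case: ifP => _; last by lia.
by rewrite edges_between_setU1l // edges_between_setU1r // degin_setU1 // e_irr; lia.
Qed.

(** At a restart every neighbour of an active vertex has been queried, so active vertices have full
    degree into the queried set. *)
Lemma restart_edges d : (forall v, degin setT v = d) -> restart S t ->
  edges_between (qd S t) (active S t) = d * #|active S t|.
Proof.
move=> dg rt; rewrite edges_betweenC /edges_between -sum1_card big_distrr /=.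
apply: eq_bigr => v va; rewrite muln1 -(dg v); congr #|pred_of_set _|; apply/setP => w.
rewrite !inE /=; case: (boolP (e v w)) => vw; rewrite ?andbF // andbT.
by rewrite (restart_notin rt va) // e_sym.
Qed.

End Sums.
End GraphExploration.

(** * Vertices not adjacent to the active set *)

Lemma expR_half_le (R : realType) : expR (1 / 2) <= 2 :> R.
Proof.
have h : 1 / 2 <= expR (- (1 / 2)) :> R.
  by apply: le_trans (expR_ge1Dx _); lra.
have /(ler_wpM2l (expR_ge0 (1 / 2 : R))) := h.
by rewrite -expRD subrr expR0; lra.
Qed.

Lemma expR_le8 (R : realType) (x : R) : x <= 3 / 2 -> expR x <= 8.
Proof.
move=> x32; apply: (@le_trans _ _ (expR (3%:R * (1 / 2)))).
  by rewrite ler_expR; lra.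
rewrite expRM_natl (_ : 8 = 2 ^+ 3); last by ring.
by rewrite lerXn2r ?nnegrE ?expR_ge0 // expR_half_le.
Qed.

Lemma expR_dist (R : realType) (x y : R) : x <= 3 / 2 -> y <= 3 / 2 ->
  `|expR x - expR y| <= 8 * `|x - y|.
Proof.
have K (a b : R) : b <= a -> a <= 3 / 2 -> `|expR a - expR b| <= 8 * (a - b).
  move=> ba a32; rewrite ger0_norm ?subr_ge0 ?ler_expR //.
  have -> : expR a - expR b = expR a * (1 - expR (b - a)).
    by rewrite mulrBr mulr1 -expRD; congr (_ - expR _); ring.
  apply: (@le_trans _ _ (expR a * (a - b))).
    by apply: ler_wpM2l; [exact: expR_ge0 | have := expR_ge1Dx (b - a); lra].
  by apply: ler_wpM2r; [rewrite subr_ge0 | exact: expR_le8].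
move=> x32 y32; have [yx|/ltW xy] := lerP y x; first exact: K.
by rewrite distrC K.
Qed.

(** The exponent of the power is k l with l = - ln (1 - p) = p + O(p^2), and k (l - p) <= d (l - p)
    <= 2 p. Both exponents stay below 3/2, where exp is 8-Lipschitz. *)
Lemma expr_inv_approx (R : realType) (p c s : R) (k d : nat) :
  0 < p <= 1 / 100 -> p * d%:R = c -> c <= 11 / 10 -> (k <= d)%N -> 0 <= s <= 1 ->
  `|(1 - p)^-1 ^+ k - expR (c * s)| <= 8 * (p * `|k%:R - d%:R * s| + 2 * p).
Proof.
move=> /andP[p0 p1] pd c1 kd /andP[s0 s1].
have q0 : 0 < 1 - p by lra.
pose l := - ln (1 - p).
have lE : expR l = (1 - p)^-1 by rewrite /l expRN lnK.
have pl : p <= l.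
  by rewrite /l lerNr -ler_expR lnK ?posrE // (le_trans _ (expR_ge1Dx _)).
have lu : l <= p + (100 / 99) * p ^+ 2.
  apply: (@le_trans _ _ (p / (1 - p))).
    rewrite -ler_expR lE; apply: le_trans (expR_ge1Dx _).
    by rewrite le_eqVlt; apply/orP; left; apply/eqP; field; rewrite gt_eqF.
  rewrite ler_pdivrMr //.
  have : 0 <= p ^+ 2 * (1 - 100 * p) by rewrite mulr_ge0 ?sqr_ge0 //; lra.
  by lra.
have kR : (k%:R : R) <= d%:R by rewrite ler_nat.
have k0 : (0 : R) <= k%:R by [].
have lp0 : 0 <= l - p by lra.
have d1 : d%:R * (l - p) <= 2 * p.
  have : d%:R * (l - p) <= d%:R * (100 / 99 * p ^+ 2) by rewrite ler_wpM2l //; lra.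
  have -> : d%:R * (100 / 99 * p ^+ 2) = 100 / 99 * c * p by rewrite -pd; field.
  have : c * p <= 11 / 10 * p by rewrite ler_wpM2r // ltW.
  by lra.
have kl : k%:R * (l - p) <= d%:R * (l - p) by rewrite ler_wpM2r.
have klE : k%:R * l = p * k%:R + k%:R * (l - p) by ring.
have pk : p * k%:R <= c by rewrite -pd ler_wpM2l // ltW.
rewrite -lE -expRM_natl.
have c0 : 0 <= c by rewrite -pd mulr_ge0 // ltW.
have cs : c * s <= c by rewrite ler_piMr.
apply: le_trans (expR_dist _ _) _; [by rewrite klE; lra | by lra |].
rewrite ler_wpM2l // klE.
have -> : p * k%:R + k%:R * (l - p) - c * s = p * (k%:R - d%:R * s) + k%:R * (l - p).
  by rewrite -pd; ring.
rewrite (le_trans (ler_normD _ _)) // lerD //.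
  by rewrite normrM gtr0_norm.
by rewrite ger0_norm ?mulr_ge0 //; lra.
Qed.

Section Unseen.
Context (R : realType) (V : finType) (e : rel V) (v0 : V).
Hypotheses (e_sym : symmetric e) (e_irr : irreflexive e).
Variable p : R.
Hypotheses (p_gt0 : 0 < p) (p_lt1 : p < 1).
Local Notation q := ((1 - p)^-1).
Local Notation nxt := (bfs_next e v0).

(* Querying v multiplies the weight of a neighbour u of v by 0 with probability
   p and by 1 / (1 - p) otherwise, so the total weight is a martingale. *)
Definition unseen_weight Q K : R :=
  \sum_(u | u \notin nbhd e K) q ^+ degin e Q u.
(** If X is the weight of the unseen neighbours of the next vertex, the increment is -X when that
    vertex is active and ((1 - p)^-1 - 1) X otherwise. *)
Definition unseen_coef Q K : R :=
  - \sum_(u | (u \notin nbhd e K) && e u (nxt Q K)) q ^+ (degin e Q u).+1.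

Let q0 : 0 < 1 - p. Proof. by rewrite subr_gt0. Qed.
Let q1 : 1 <= q.
Proof. by rewrite invf_ge1 // gerBl ltW. Qed.

Lemma unseen_weight_martingale S t : (t <= #|V|)%N ->
  unseen_weight (queried nxt S t) (active e v0 S t) =
  #|V|%:R + \sum_(j < t) incr p nxt unseen_coef S (queried nxt S j).
Proof.
elim: t => [|t IH] tV.
  rewrite big_ord0 addr0 /unseen_weight.
  have -> : #|V|%:R = \sum_(u : V) 1 :> R by rewrite sumr_const.
  apply: eq_big => u.
    by apply/negP => /nbhdP[w]; rewrite /active inE in_set0.
  by move=> _; rewrite /degin (_ : finset _ = set0) ?cards0 //;
     apply/setP => w; rewrite !inE.
rewrite big_ord_recr /= addrA -IH ?(ltnW tV) //.
rewrite /incr -/(active e v0 S t) -/(asked nxt S t) /unseen_coef -/(asked nxt S t).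
have vq := asked_notin e v0 S tV; have va := active_notin e v0 S tV.
move: vq va; set v := asked _ _ _; set Q := queried _ _ t => vq va.
rewrite /unseen_weight.
rewrite [X in _ = X + _](bigID (fun u => e u v)) /=.
rewrite (bigID (fun u => e u v)) /=.
(* The query of [v] does not affect the contribution of vertices not adjacent to [v]. *)
have E2 (K : {set V}) (P : pred V) : (forall u, ~~ e u v -> (u \in nbhd e K) = P u) ->
   \sum_(u | (u \notin nbhd e K) && ~~ e u v) q ^+ degin e (queried nxt S t.+1) u =
   \sum_(u | (~~ P u) && ~~ e u v) q ^+ degin e Q u.
  move=> H; apply: eq_big => [u|u /andP[_ euv]].
    by case: (boolP (e u v)) => euv; rewrite ?andbF // H.
  by rewrite queriedS degin_setU1 // (negPf euv).
rewrite (E2 _ (fun u => u \in nbhd e (active e v0 S t))); last first.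
  move=> u euv; rewrite activeS -/v; case: ifP => // _.
  by rewrite !inE degin_setU1 // (negPf euv).
set Y := \sum_(u | _ && ~~ _) _.
set Z := \sum_(u | _ && _) q ^+ (degin e Q u).+1.
set X := \sum_(u | _ && e u v) q ^+ degin e Q u.
have ZX : Z = q * X by rewrite mulr_sumr; apply: eq_bigr => u _; rewrite exprS.
have qE : q * (1 - p) = 1 by rewrite mulVf // gt_eqF.
rewrite activeS -/v; case: ifP => vS.
  rewrite big_pred0 ?add0r => [|u].
    rewrite ZX /=.
    by have -> : - (q * X) * (1 - p) = - (q * (1 - p)) * X; [ring | rewrite qE; ring].
  apply/negP => /andP[/negP H euv]; apply: H; apply/nbhdP; exists v => //.
  by rewrite setU11.
have -> : \sum_(i | (i \notin nbhd e (active e v0 S t)) && e i v)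
   q ^+ degin e (queried nxt S t.+1) i = Z.
  by apply: eq_bigr => u /andP[_ euv]; rewrite queriedS degin_setU1 // euv.
rewrite ZX /= sub0r mulrNN.
have H : q * X - q * X * p = X.
  by transitivity (q * (1 - p) * X); [ring | rewrite qE mul1r].
by rewrite -addrA [RHS]addrC -addrA; move: H; lra.
Qed.

(** The queried vertex has [d] neighbours, each of weight at most q^(d + 1). *)
Lemma unseen_coef_bound d Q K : (forall v, degin e setT v = d) -> (q ^+ d.+1 <= 8) ->
  `|unseen_coef Q K| <= 8 * d%:R.
Proof.
move=> dg q8; rewrite normrN (le_trans (ler_norm_sum _ _ _)) //.
apply: (@le_trans _ _ (\sum_(u | e u (nxt Q K)) 8)).
  rewrite big_mkcond [leRHS]big_mkcond; apply: ler_sum => u _ /=.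
  case: (boolP (e u _)) => euv; rewrite ?andbF // andbT; case: ifP => // _.
  rewrite ger0_norm; last by rewrite exprn_ge0 // ltW // invr_gt0.
  apply: le_trans q8; rewrite ler_weXn2l // ltnS -(dg u).
  by apply: degin_subset; rewrite subsetT.
rewrite sumr_const -[leLHS]mulr_natr ler_wpM2l // ler_nat -(dg (nxt Q K)).
by apply: subset_leq_card; apply/subsetP => u; rewrite !inE e_sym.
Qed.

End Unseen.

Section DegreeDeviation.
Context (R : realType) (n d : nat) (lam : R) (V : finType) (e : rel V).
Hypothesis Ge : ndl_graph n d lam e.
Hypotheses (lam_gt0 : 0 < lam) (lam_lt : lam < d%:R).

Let sum_cst (c : R) : \sum_(u : V) c = c * n%:R.
Proof. by case: Ge => _ _ <- _ _; rewrite sumr_const -[LHS]mulr_natr. Qed.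

Lemma ndl_degin v : degin e setT v = d.
Proof.
case: Ge => _ _ _ dg _; rewrite -(dg v); congr #|pred_of_set _|.
by apply/setP => u; rewrite !inE.
Qed.

Lemma sum_degree_deviation (Q : {set V}) :
  \sum_u `|(degin e Q u)%:R - d%:R * #|Q|%:R / n%:R| <= lam * n%:R.
Proof.
have Vn : #|V| = n by case: Ge.
have lam0 : lam != 0 by rewrite gt_eqF.
(* The arithmetic-geometric inequality, which turns the variance bound into a first moment bound. *)
have H x : `|x| <= x ^+ 2 / (2 * lam) + lam / 2.
  rewrite -[x ^+ 2]real_normK ?num_real // -subr_ge0.
  have -> : `|x| ^+ 2 / (2 * lam) + lam / 2 - `|x| = (`|x| - lam) ^+ 2 / (2 * lam).
    by field.
  by rewrite divr_ge0 ?sqr_ge0 // mulr_ge0 // ltW.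
apply: le_trans (ler_sum _ (fun u _ => H _)) _.
rewrite big_split /= -mulr_suml sum_cst.
have QV : (#|Q|%:R : R) <= n%:R by rewrite ler_nat -Vn max_card.
have HX : \sum_u ((degin e Q u)%:R - d%:R * #|Q|%:R / n%:R) ^+ 2 <= lam ^+ 2 * #|Q|%:R
  := degree_variance Ge lam_lt Q.
move: HX; set X := \sum_u _ => HX.
have : X / (2 * lam) <= lam ^+ 2 * #|Q|%:R / (2 * lam).
  by rewrite ler_pM2r // invr_gt0 mulr_gt0.
have -> : lam ^+ 2 * #|Q|%:R / (2 * lam) = lam * #|Q|%:R / 2 by field.
have : lam * #|Q|%:R <= lam * n%:R by rewrite ler_pM2l.
by lra.
Qed.

Lemma edges_between_deviation (Q : {set V}) :
  `|(edges_between e Q Q)%:R - d%:R * #|Q|%:R ^+ 2 / n%:R| <= lam * n%:R.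
Proof.
apply: le_trans (sum_degree_deviation Q).
have -> : (edges_between e Q Q)%:R - d%:R * #|Q|%:R ^+ 2 / n%:R =
   \sum_(u in Q) ((degin e Q u)%:R - d%:R * #|Q|%:R / n%:R) :> R.
  rewrite sumrB -natr_sum sumr_const -[_ *+ #|_|]mulr_natr; congr (_ - _).
  by rewrite expr2; ring.
rewrite (le_trans (ler_norm_sum _ _ _)) // [leRHS](bigID (fun u => u \in Q)) /=.
by rewrite lerDl sumr_ge0.
Qed.

(** The variance bound for a single vertex. It will show that a small ratio [lam / d] forces a large
    degree, hence a small [p]. *)
Lemma lam_sqr_ge : (0 < n)%N -> d%:R * (1 - d%:R / n%:R) <= lam ^+ 2.
Proof.
move=> n0; have Vn : #|V| = n by case: Ge.
have /card_gt0P[v _] : (0 < #|V|)%N by rewrite Vn.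
have nR : (n%:R : R) != 0 by rewrite pnatr_eq0 -lt0n.
have := degree_variance Ge lam_lt [set v]; rewrite cards1 !mulr1.
have es : symmetric e by case: Ge.
have dE u : #|[set w in [set v] | e u w]| = e v u.
  rewrite es; case: (boolP (e u v)) => H.
    by rewrite (_ : finset _ = [set v]) ?cards1 //; apply/setP => w; rewrite !inE;
      case: eqVneq => [->|].
  by rewrite (_ : finset _ = set0) ?cards0 //; apply/setP => w; rewrite !inE;
      case: eqVneq => [->|] //=; rewrite ?(negPf H).
under eq_bigr do rewrite dE.
have -> : \sum_u ((e v u)%:R - d%:R / n%:R) ^+ 2 =
   \sum_u ((1 - 2 * (d%:R / n%:R)) * (e v u)%:R + (d%:R / n%:R) ^+ 2) :> R.
  by apply: eq_bigr => u _; case: (e v u) => /=; ring.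
rewrite big_split /= -mulr_sumr -natr_sum sum_cst.
have -> : \sum_u (e v u : nat) = d.
  by rewrite -(ndl_degin v) deginE; apply: eq_bigl => u; rewrite inE.
suff -> : (1 - 2 * (d%:R / n%:R)) * d%:R + (d%:R / n%:R) ^+ 2 * n%:R =
   d%:R * (1 - d%:R / n%:R) :> R by [].
by field.
Qed.

(** Most vertices have about d |Q| / n neighbours in [Q], so an unseen vertex weighs about E = exp
    (c |Q| / n). As the total weight is about n, about n / E vertices are unseen. *)
Lemma unseen_card (p c w : R) (Q K : {set V}) : 0 < p <= 1 / 100 -> p * d%:R = c ->
  1 <= c <= 11 / 10 -> (0 < n)%N ->
  `|unseen_weight e p Q K - n%:R| <= w * n%:R ->
  `|#|nbhd e K|%:R - n%:R * (1 - expR (- (c * (#|Q|%:R / n%:R))))|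
    <= (w + 8 * (c * (lam / d%:R) + 2 * p)) * n%:R.
Proof.
move=> pp pd /andP[c1 c2] n0 Hw.
have Vn : #|V| = n by case: Ge.
have nR : (0 : R) < n%:R by rewrite ltr0n.
have dR : (0 : R) < d%:R by exact: lt_trans lam_lt.
set s := #|Q|%:R / n%:R.
have s01 : 0 <= s <= 1.
  by rewrite /s divr_ge0 //= ler_pdivrMr // mul1r ler_nat -Vn max_card.
pose E := expR (c * s).
have E1 : 1 <= E.
  by apply: le_trans (expR_ge1Dx _); rewrite lerDl mulr_ge0 //; [lra | case/andP: s01].
pose Z : R := #|~: nbhd e K|%:R.
have ZE : #|nbhd e K|%:R = n%:R - Z.
  by rewrite /Z -Vn -(cardsC (nbhd e K)) natrD; ring.
have dev : `|E * Z - unseen_weight e p Q K| <= 8 * (c * (lam / d%:R) + 2 * p) * n%:R.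
  have -> : E * Z = \sum_(u | u \notin nbhd e K) E.
    by rewrite sumr_const -[_ *+ #|_|]mulr_natr /Z; congr (_ * _%:R); apply: eq_card => u; rewrite in_setC unfold_in.
  rewrite -sumrB (le_trans (ler_norm_sum _ _ _)) //.
  apply: (@le_trans _ _ (\sum_u 8 * (p * `|(degin e Q u)%:R - d%:R * s| + 2 * p))).
    rewrite [leRHS](bigID (fun u => u \notin nbhd e K)) /=.
    rewrite ler_wpDr ?sumr_ge0 //.
      by move=> u _; rewrite mulr_ge0 // addr_ge0 // mulr_ge0 //; case/andP: pp => /ltW.
    apply: ler_sum => u _; rewrite distrC; apply: expr_inv_approx => //.
    by rewrite -(ndl_degin u); apply: degin_subset; rewrite subsetT.
  rewrite -mulr_sumr big_split /= sum_cst -mulr_sumr.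
  have := sum_degree_deviation Q; under eq_bigr do rewrite -mulrA -/s.
  set X := \sum_u _ => HX.
  rewrite -[leRHS]mulrA ler_wpM2l // [leRHS]mulrDl lerD2r -pd.
  have -> : p * d%:R * (lam / d%:R) * n%:R = p * (lam * n%:R) by field; rewrite gt_eqF.
  by rewrite ler_wpM2l //; case/andP: pp => /ltW.
have Hd : `|E * Z - n%:R| <= (w + 8 * (c * (lam / d%:R) + 2 * p)) * n%:R.
  have := ler_distD (unseen_weight e p Q K) (E * Z) n%:R.
  by rewrite mulrDl; lra.
(* Dividing by [E >= 1] does not increase the error. *)
apply: le_trans Hd; rewrite ZE expRN -/E.
have -> : n%:R - Z - n%:R * (1 - E^-1) = - (E^-1 * (E * Z - n%:R)).
  by field; rewrite gt_eqF // (lt_le_trans _ E1).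
rewrite normrN normrM ler_piMl // ger0_norm ?invr_ge0 ?(le_trans _ E1) //.
by rewrite invf_le1 // (lt_le_trans _ E1).
Qed.

End DegreeDeviation.

(** * The survival function *)

Lemma expR_tangent (R : realType) (y z : R) : expR z * (1 + (y - z)) <= expR y.
Proof.
have -> : expR y = expR z * expR (y - z) by rewrite -expRD; congr expR; ring.
by rewrite ler_wpM2l ?expR_ge0 // expR_ge1Dx.
Qed.

(** Obtained from (1 + x / 2)^2 <= exp x. A quadratic coefficient below 1 is what later gives c * s1
    > eps, hence a slope below 1 at the fixed point. *)
Lemma expRN_le (R : realType) (x : R) : 0 <= x -> expR (- x) <= 1 - x + 3 / 4 * x ^+ 2.
Proof.
move=> x0; have h : (1 + x / 2) ^+ 2 <= expR x.
  have -> : x = 2%:R * (x / 2) by field.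
  rewrite expRM_natl (_ : 2%:R * (x / 2) / 2 = x / 2); last by field.
  by rewrite lerXn2r ?nnegrE ?expR_ge0 ?expR_ge1Dx //; lra.
have h2 : expR (- x) * (1 + x / 2) ^+ 2 <= 1.
  by rewrite -[leRHS](mulVf (lt0r_neq0 (expR_gt0 x))) -expRN ler_wpM2l ?expR_ge0.
have h3 : 0 < (1 + x / 2) ^+ 2 by rewrite exprn_gt0 //; lra.
rewrite -(ler_pM2r h3) (le_trans h2) // -subr_ge0.
have -> : (1 - x + 3 / 4 * x ^+ 2) * (1 + x / 2) ^+ 2 - 1 =
  1 / 2 * x ^+ 3 + 3 / 16 * x ^+ 4 by field.
by rewrite addr_ge0 // mulr_ge0 // ?exprn_ge0 //; lra.
Qed.

Lemma sqr_1D_le (R : realType) (eps : R) : 0 < eps -> eps <= 1 / 100 ->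
  (1 + eps) ^+ 2 <= 11 / 10.
Proof.
move=> e0 e1; have : eps ^+ 2 <= eps * (1 / 100) by rewrite expr2 ler_pM2l.
by rewrite sqrrD expr1n mul1r mulr2n; lra.
Qed.

Section Scalar.
Context (R : realType) (eps al : R).
Hypotheses (eps_gt0 : 0 < eps) (eps_le : eps <= 1 / 100).
Hypotheses (al_gt0 : 0 < al) (al_le : 100 * al <= eps / 100).
Local Notation c := (1 + eps).

(** Its positive fixed point [s1] is the survival probability of a branching process with Poisson
    offspring of mean c; the x of the theorem is c * s1. *)
Definition survive (s : R) : R := 1 - expR (- (c * s)).

Variable s1 : R.
Hypotheses (s1_gt0 : 0 < s1) (s1_lt1 : s1 < 1) (s1E : s1 = survive s1).

Let expE : expR (- (c * s1)) = 1 - s1.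
Proof. by move: s1E; rewrite /survive; lra. Qed.

Lemma survive_fixpoint_ge : 5 / 4 * eps <= c * s1.
Proof.
have [[E0 E1] [S0 S1]] := ((eps_gt0, eps_le), (s1_gt0, s1_lt1)).
set x := c * s1; have x0 : 0 < x by rewrite mulr_gt0 //; lra.
have := expRN_le (ltW x0); rewrite {1}/x expE => H.
have H3 : c * (x - 3 / 4 * x ^+ 2) <= x.
  have -> : x = c * s1 by [].
  by rewrite ler_wpM2l //; [lra | rewrite -/x; lra].
have H4 : x * (c * (1 - 3 / 4 * x)) <= x * 1.
  by have -> : x * (c * (1 - 3 / 4 * x)) = c * (x - 3 / 4 * x ^+ 2); [ring | lra].
rewrite ler_pM2l // in H4.
have : c * x <= 101 / 100 * x by rewrite ler_wpM2r ?(ltW x0) //; lra.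
by move: H4; rewrite mulrBr mulr1 mulrCA; lra.
Qed.

(** The left side is the derivative of [survive] at [s1]. *)
Lemma survive_slope : c * (1 - s1) <= 1 - eps / 4.
Proof. by have := survive_fixpoint_ge; rewrite mulrBr; lra. Qed.

(** The bound is checked at the two endpoints and extended to the interval by concavity. *)
Lemma survive_above_diag s : al <= s <= s1 - al -> eps / 4 * al - 3 * al ^+ 2 <= survive s - s.
Proof.
have [E0 E1 A0 A1] := And4 eps_gt0 eps_le al_gt0 al_le.
have [S0 S1] := conj s1_gt0 s1_lt1.
move=> /andP[sa sb]; set a := al; set b := s1 - al; rewrite /survive.
have b0 : 0 < b - a \/ b - a = 0.
  by case: (ltrgtP (b - a) 0) => H; [move: H; rewrite /a /b; lra | left | right].
have c1 : c <= 101 / 100 by lra.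
have sq : 2 * (c * al) ^+ 2 <= 3 * al ^+ 2.
  have -> : 2 * (c * al) ^+ 2 = (2 * c ^+ 2) * al ^+ 2 by ring.
  rewrite ler_wpM2r ?sqr_ge0 //.
  by have := sqr_1D_le E0 E1; lra.
have cal : 0 < c * al by rewrite mulr_gt0 //; lra.
have cal3 : c * al <= 101 / 100 * al by rewrite ler_wpM2r // ltW.
have cal2 : c * al <= 1 / 2 by lra.
have ha : eps / 4 * al - 3 * al ^+ 2 <= 1 - expR (- (c * a)) - a.
  have : expR (- (c * a)) <= 1 + - (c * a) + 2 * (- (c * a)) ^+ 2.
    by apply: expR_le_quad; rewrite /a; lra.
  have : 0 <= eps * al by rewrite mulr_ge0 // ltW.
  by rewrite sqrrN /a; move: sq; lra.
have hb : eps / 4 * al - 3 * al ^+ 2 <= 1 - expR (- (c * b)) - b.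
  have -> : expR (- (c * b)) = (1 - s1) * expR (c * al).
    by rewrite -expE -expRD; congr expR; rewrite /b; ring.
  have E := expR_le_quad cal2.
  have s1' : 0 <= 1 - s1 by lra.
  have : (1 - s1) * expR (c * al) <= (1 - s1) * (1 + c * al + 2 * (c * al) ^+ 2).
    by rewrite ler_wpM2l.
  have : (1 - s1) * (2 * (c * al) ^+ 2) <= 3 * al ^+ 2.
    by apply: le_trans sq; rewrite ler_piMl ?mulr_ge0 ?sqr_ge0 //; lra.
  have : (1 - s1) * (c * al) <= (1 - eps / 4) * al.
    by rewrite mulrA ler_wpM2r ?(ltW A0) // mulrC survive_slope.
  by rewrite /b; lra.
case: b0 => [b0|b0]; last first.
  have -> : s = a by move: b0 sa sb; rewrite /a /b; lra.
  exact: ha.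
(* Concavity by hand: the tangent at s is compared with both endpoints, with weights b - s and s -
   a. *)
have T1 := expR_tangent (- (c * a)) (- (c * s)).
have T2 := expR_tangent (- (c * b)) (- (c * s)).
have bs : 0 <= b - s by rewrite /b; lra.
have as_ : 0 <= s - a by rewrite /a; lra.
rewrite -(ler_pM2l b0).
set k := eps / 4 * al - 3 * al ^+ 2 in ha hb *.
set Ea := expR (- (c * a)) in ha T1; set Eb := expR (- (c * b)) in hb T2.
set Es := expR (- (c * s)) in T1 T2 *.
have B1 := ler_wpM2l bs T1; have B2 := ler_wpM2l as_ T2.
have B3 := ler_wpM2l bs ha; have B4 := ler_wpM2l as_ hb.
have : (b - s) * (Es * (1 + (- (c * a) - - (c * s)))) +
       (s - a) * (Es * (1 + (- (c * b) - - (c * s)))) = (b - a) * Es by ring.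
move: B1 B2 B3 B4; clear; lra.
Qed.


(** Past [s1] the graph lies below its tangent there, so [survive s - s] is at most - (eps / 4) (s -
    s1). *)
Lemma survive_below_diag s k : 0 <= k -> - k <= survive s - s -> s <= s1 + 4 * k / eps.
Proof.
have [E0 E1 A0 A1] := And4 eps_gt0 eps_le al_gt0 al_le.
have [S0 S1] := conj s1_gt0 s1_lt1.
move=> k0 H; have k0' : 0 <= 4 * k / eps by rewrite divr_ge0 ?mulr_ge0 // ltW.
have [ss|/ltW ss] := lerP s s1; first by lra.
have := expR_tangent (- (c * s)) (- (c * s1)); rewrite expE => T.
have : (1 - s1) * (1 + (- (c * s) - - (c * s1))) = (1 - s1) - c * (1 - s1) * (s - s1) by ring.
have : c * (1 - s1) * (s - s1) <= (1 - eps / 4) * (s - s1).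
  by rewrite ler_wpM2r ?subr_ge0 // survive_slope.
move: H; rewrite /survive => H H1 H2.
rewrite -lerBlDl ler_pdivlMr //.
by lra.
Qed.

(** By concavity the increment is at most the slope at [a] times b - a. Moving back from [s1] by
    [al] multiplies the slope by at most exp (c al) <= 1 + eps / 100. *)
Lemma survive_contract a b : s1 - al <= a -> a <= b ->
  survive b - survive a <= (1 - eps / 8) * (b - a).
Proof.
have [E0 E1 A0 A1] := And4 eps_gt0 eps_le al_gt0 al_le.
have [S0 S1] := conj s1_gt0 s1_lt1.
move=> ha ab; rewrite /survive.
have T := expR_tangent (- (c * b)) (- (c * a)).
have Ea : c * expR (- (c * a)) <= 1 - eps / 8.
  have cal : 0 < c * al by rewrite mulr_gt0 //; lra.
  have cal3 : c * al <= 101 / 100 * al by rewrite ler_wpM2r ?(ltW A0) //; lra.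
  have cal2 : c * al <= 1 / 2 by lra.
  have h1 : expR (- (c * a)) <= (1 - s1) * expR (c * al).
    rewrite -expE -expRD ler_expR.
    have : c * (s1 - al) <= c * a by rewrite ler_wpM2l //; lra.
    by rewrite mulrBr; lra.
  have h2 : expR (c * al) <= 1 + eps / 100.
    apply: (le_trans (expR_le_quad cal2)).
    have : (c * al) ^+ 2 <= c * al * (1 / 2) by rewrite expr2 ler_wpM2l // ltW.
    by lra.
  have s1' : 0 <= 1 - s1 by lra.
  have c0 : 0 <= c by lra.
  have h3 : c * expR (- (c * a)) <= c * (1 - s1) * expR (c * al).
    by rewrite -mulrA ler_wpM2l.
  have h4 : c * (1 - s1) * expR (c * al) <= (1 - eps / 4) * (1 + eps / 100).
    by apply: ler_pM survive_slope h2; [rewrite mulr_ge0 | exact: expR_ge0].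
  by have := sqr_ge0 eps; lra.
have ba : 0 <= b - a by lra.
have := ler_wpM2r ba Ea.
have : expR (- (c * a)) * (1 + (- (c * b) - - (c * a))) =
  expR (- (c * a)) - c * expR (- (c * a)) * (b - a) by ring.
by lra.
Qed.

End Scalar.

(** * The giant component of a typical exploration *)

(** [X] and [Y] stand for the edges inside the active set at the restarts before and after the
    giant, [sA] and [sB] for those times over n. Replacing [sA] by 0 and [sB] by [s1] costs at most
    11/10 times al and 8 al / eps respectively. *)
Lemma giant_edges_error (R : realType) (eps al r sA sB s1 X Y : R) :
  0 < eps -> eps <= 1 / 100 -> 0 < al -> 100 * al <= eps / 100 -> 0 < r ->
  0 <= sA -> sA <= al -> 0 < s1 -> s1 < 1 -> sB <= 1 -> 0 <= sB ->
  s1 - al <= sB -> sB <= s1 + 8 * al / eps ->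
  `|X - r * ((1 + eps) ^+ 2 * (sA - sA ^+ 2 / 2))| <= 20 * al ^+ 2 * r ->
  `|Y - r * ((1 + eps) ^+ 2 * (sB - sB ^+ 2 / 2))| <= 20 * al ^+ 2 * r ->
  `|Y - X - r * ((1 + eps) ^+ 2 * (s1 - s1 ^+ 2 / 2))| <= 12 * al / eps * r.
Proof.
move=> E0 E1 A0 A1 R0 sA0 sA1 S0 S1 sB1 sB0 lo hi HX HY.
have c2 := sqr_1D_le E0 E1; have c20 := sqr_ge0 (1 + eps).
set c := (1 + eps) ^+ 2 in c2 c20 HX HY *.
set de := 8 * al / eps in hi.
have -> : 12 * al / eps = 3 / 2 * de by rewrite /de; field; rewrite gt_eqF.
have de8 : 100 * al <= de by rewrite /de ler_pdivlMr //; nra.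
have gA : `|c * (sA - sA ^+ 2 / 2)| <= 11 / 10 * al.
  rewrite normrM (ger0_norm c20); apply: ler_pM => //.
  have sq : sA ^+ 2 <= sA * 1 by rewrite expr2 ler_wpM2l //; lra.
  have sq0 := sqr_ge0 sA.
  by rewrite ler_norml; apply/andP; split; lra.
have gB : `|c * (sB - sB ^+ 2 / 2) - c * (s1 - s1 ^+ 2 / 2)| <= 11 / 10 * de.
  have -> : c * (sB - sB ^+ 2 / 2) - c * (s1 - s1 ^+ 2 / 2) =
    c * ((sB - s1) * (1 - (sB + s1) / 2)) by field.
  rewrite normrM (ger0_norm c20); apply: ler_pM => //.
  rewrite normrM -[de]mulr1; apply: ler_pM => //; rewrite ler_norml; lra.
have -> : Y - X - r * (c * (s1 - s1 ^+ 2 / 2)) =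
   (Y - r * (c * (sB - sB ^+ 2 / 2))) - (X - r * (c * (sA - sA ^+ 2 / 2)))
   + r * (c * (sB - sB ^+ 2 / 2) - c * (s1 - s1 ^+ 2 / 2)) - r * (c * (sA - sA ^+ 2 / 2)).
  by ring.
move: HX HY gA gB.
set GA := c * (sA - _); set GB := c * (sB - _) - _.
set dX := X - _; set dY := Y - _ => HX HY gA gB.
have h1 : `|r * GB| <= r * (11 / 10 * de) by rewrite normrM gtr0_norm // ler_pM2l.
have h2 : `|r * GA| <= r * (11 / 10 * al) by rewrite normrM gtr0_norm // ler_pM2l.
apply: le_trans (ler_normB _ _) _; apply: le_trans (lerD (ler_normD _ _) (lexx _)) _.
have h3 := ler_normB dY dX.
have a2 : al ^+ 2 * r <= al * (1 / 100) * r.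
  by rewrite ler_pM2r // expr2 ler_pM2l //; lra.
have k : r * al <= r * (de / 100) by rewrite ler_pM2l //; lra.
have ra : 0 < r * al by rewrite mulr_gt0.
clear lo hi gA gB c2 c20 de8 sB0 sB1 sA0 sA1 S0 S1 E0 E1 A1.
by lra.
Qed.

Section Giant.
Context (R : realType) (V : finType) (e : rel V) (v0 : V).
Hypotheses (e_sym : symmetric e) (e_irr : irreflexive e).
Variables (eps al s1 r : R) (S : {set V}).
Local Notation c := (1 + eps).
Local Notation n := (#|V|%:R : R).
Local Notation act := (active e v0 S).
Hypotheses (eps_gt0 : 0 < eps) (eps_le : eps <= 1 / 100).
Hypotheses (al_gt0 : 0 < al) (al_le : 100 * al <= eps / 100).
Hypotheses (s1_gt0 : 0 < s1) (s1_lt1 : s1 < 1) (s1E : s1 = survive eps s1).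
Hypotheses (r_gt0 : 0 < r) (n_large : 1 <= al ^+ 2 * n).
Hypothesis act_card : forall t, (t <= #|V|)%N ->
  `|#|act t|%:R - c * (t%:R / n) * r| <= al ^+ 2 * r.
Hypothesis nbhd_card : forall t, (t <= #|V|)%N ->
  `|#|nbhd e (act t)|%:R - n * survive eps (t%:R / n)| <= 20 * al ^+ 2 * n.
Hypothesis act_edges : forall t, (t <= #|V|)%N -> restart e v0 S t ->
  `|(edges_between e (act t) (act t))%:R / 2
     - r * (c ^+ 2 * (t%:R / n - (t%:R / n) ^+ 2 / 2))| <= 20 * al ^+ 2 * r.

Let n_gt0 : 0 < n.
Proof.
rewrite ltr0n lt0n; apply/eqP => V0.
by have := n_large; rewrite V0 mulr0 ler10.
Qed.

Let al2 : 100 * al ^+ 2 <= eps / 100 * al.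
Proof. by rewrite expr2 mulrA ler_wpM2r // ltW. Qed.

Let s1_ge : 6 / 5 * eps <= s1.
Proof.
have [E0 E1] := conj eps_gt0 eps_le.
have := survive_fixpoint_ge eps_gt0 eps_le s1_gt0 s1_lt1 s1E.
have : c * s1 <= 101 / 100 * s1 by rewrite ler_wpM2r ?(ltW s1_gt0) //; lra.
by lra.
Qed.

Lemma act_diff a b : (a <= b)%N -> (b <= #|V|)%N ->
  `|#|act b :\: act a|%:R - c * (b%:R / n - a%:R / n) * r| <= 2 * al ^+ 2 * r.
Proof.
move=> ab bV; have sab := active_subset e v0 S ab.
rewrite cardsDS // natrB ?subset_leq_card //.
have H1 := act_card bV; have H2 := act_card (leq_trans ab bV).
rewrite (_ : _ - _ = (#|act b|%:R - c * (b%:R / n) * r) -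
   (#|act a|%:R - c * (a%:R / n) * r)); last by ring.
by rewrite (le_trans (ler_normB _ _)) //; lra.
Qed.

Lemma giant_interval : exists a b : nat,
  [/\ (a < b <= #|V|)%N, restart e v0 S a, restart e v0 S b,
      forall i, (a < i < b)%N -> ~~ restart e v0 S i
    & [/\ a%:R / n <= al, s1 - al <= b%:R / n & b%:R / n <= s1 + 8 * al / eps]].
Proof.
have [E0 E1 A0 A1] := And4 eps_gt0 eps_le al_gt0 al_le.
have [S0 S1 n0 AL2] := And4 s1_gt0 s1_lt1 n_gt0 al2.
(* From about this time on, [survive] clears the diagonal by more than the error terms. *)
pose t := Num.truncn (al * n).
have /andP[tle tgt] : t%:R <= al * n < t.+1%:R.
  by apply: truncn_itv; rewrite mulr_ge0 // ltW.
have tV : (t < #|V|)%N.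
  rewrite -(ltr_nat R) (le_lt_trans tle) // gtr_pMl //; lra.
have [a [b [/andP[at_ tb] bV ra rb rab]]] := restart_interval e v0 S tV.
have ab := leq_ltn_trans at_ tb.
exists a, b; rewrite ab bV; split=> //.
have sa : a%:R / n <= al.
  by rewrite ler_pdivrMr // (le_trans _ tle) // ler_nat.
have sbal : al <= b%:R / n.
  by rewrite ler_pdivlMr // (le_trans (ltW tgt)) // ler_nat.
have nb := nbhd_card bV; rewrite ler_norml in nb; case/andP: nb => nb1 nb2.
set sb := b%:R / n in sbal nb1 nb2 *.
have bE : b%:R = sb * n by rewrite /sb divfK // gt_eqF.
(* At the restart [b] all neighbours are queried, so [survive sb] exceeds [sb] by at most the error;
   this is impossible between al and s1 - al. *)
have lo : s1 - al <= sb.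
  rewrite leNgt; apply/negP => sb1.
  have := survive_above_diag eps_gt0 eps_le al_gt0 al_le s1_gt0 s1_lt1 s1E
            (introT andP (conj sbal (ltW sb1))).
  have : (#|nbhd e (act b)|%:R : R) <= b%:R.
    by rewrite ler_nat -[X in (_ <= X)%N](card_queried e v0 S bV) subset_leq_card.
  rewrite bE => H1 H2.
  have H3 : n * (survive eps sb - sb) <= n * (20 * al ^+ 2) by lra.
  rewrite ler_pM2l // in H3.
  have : 0 < eps * al by rewrite mulr_gt0.
  by lra.
split=> //.
have := survive_below_diag eps_gt0 eps_le al_gt0 al_le s1_gt0 s1_lt1 s1E (s := sb) (k := 2 * al).
rewrite (_ : 4 * (2 * al) = 8 * al); last by ring.
apply; first by lra.
(* Since a <= al n, nearly all vertices queried by [b] are neighbours of the active set, so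
   [survive sb] cannot fall more than 2 al below [sb]. *)
have H1 : #|nbhd e (act a)|%:R + (sb * n - (a%:R + 1)) <= #|nbhd e (act b)|%:R.
  by rewrite -bE natr1 -natrB // -natrD ler_nat; exact: interval_nbhd.
have N0 : (0 : R) <= #|nbhd e (act a)|%:R by [].
have aE : a%:R <= al * n by rewrite -ler_pdivrMr.
have NL := n_large.
have H2 : sb * n <= (survive eps sb + 20 * al ^+ 2 + (al + al ^+ 2)) * n.
  by lra.
rewrite ler_pM2r // in H2.
have : eps * al <= 1 / 100 * al by rewrite ler_wpM2r // ltW.
by lra.
Qed.

Let al_sqr_r : al ^+ 2 * r <= al * r.
Proof.
have [E0 E1 A1] := And3 eps_gt0 eps_le al_le.
by rewrite ler_wpM2r ?(ltW r_gt0) // expr2 ler_piMr ?(ltW al_gt0) //; lra.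
Qed.

Let scaled_le (y : R) : y <= al -> c * y * r <= 101 / 100 * (al * r).
Proof.
have [E0 E1] := conj eps_gt0 eps_le.
move=> yal; rewrite mulrA ler_wpM2r ?(ltW r_gt0) //.
apply: (@le_trans _ _ (c * al)); first by rewrite ler_wpM2l //; lra.
by rewrite ler_wpM2r ?(ltW al_gt0) //; lra.
Qed.

Lemma early_small a : (a <= #|V|)%N -> a%:R / n <= al -> #|act a|%:R <= 4 * al * r.
Proof.
move=> aV sa; have := act_card aV; rewrite ler_norml => /andP[_].
have [A0 alr0] := conj al_sqr_r (mulr_gt0 al_gt0 r_gt0).
by have := scaled_le sa; lra.
Qed.

(** Between the two restarts the neighbourhood must grow by b - a - 1, but contraction lets it grow
    by only (1 - eps / 8) (b - a) plus errors. So b - a is small. *)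
Lemma late_small a b : (a < b <= #|V|)%N -> restart e v0 S a -> restart e v0 S b ->
  (forall i, (a < i < b)%N -> ~~ restart e v0 S i) -> s1 - al <= a%:R / n ->
  #|act b :\: act a|%:R <= 4 * al * r.
Proof.
move=> /andP[ab bV] ra rb rab sa.
have H2 := act_diff (ltnW ab) bV; rewrite ler_norml in H2; case/andP: H2 => _ H2.
have H1 : #|nbhd e (act a)|%:R + (b%:R - (a%:R + 1)) <= #|nbhd e (act b)|%:R :> R.
  by rewrite natr1 -natrB // -natrD ler_nat; exact: interval_nbhd.
have := nbhd_card bV; have := nbhd_card (leq_trans (ltnW ab) bV).
rewrite !ler_norml => /andP[na1 _] /andP[_ nb2].
move: na1 nb2 H2 sa; set x := a%:R / n; set y := b%:R / n => na1 nb2 H2 sa.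
have aE : a%:R = x * n by rewrite /x divfK // gt_eqF.
have bE : b%:R = y * n by rewrite /y divfK // gt_eqF.
have xy : x <= y by rewrite /x /y ler_pM2r ?invr_gt0 // ler_nat ltnW.
have ct := survive_contract eps_gt0 eps_le al_gt0 al_le s1_gt0 s1_lt1 s1E sa xy.
have H4 : y - x <= al.
  have [NL n0] := conj n_large n_gt0.
  (* 41 = 20 + 20 + 1: two neighbourhood errors, and the query at the restart, paid by 1 <= al^2
     n. *)
  have H3 : n * (y - x) <= n * (survive eps y - survive eps x + 41 * al ^+ 2).
    by rewrite aE bE in H1; lra.
  rewrite ler_pM2l // in H3; have AL2 := al2.
  have ea : 0 < eps * al by rewrite mulr_gt0.
  have H4 : eps * (y - x) <= eps * al by clear na1 nb2 H1 H2 aE bE NL; lra.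
  by rewrite ler_pM2l in H4.
have [A0 alr0] := conj al_sqr_r (mulr_gt0 al_gt0 r_gt0).
have := scaled_le H4; clear na1 nb2 H1 ct aE bE sa xy H4.
by lra.
Qed.

(** The component [L] found around time al n has more than 4 al r vertices, while components found
    earlier or later have at most that many; hence [L] is the only largest one. *)
Lemma giant_edges : edges_L1_within e (r * (c ^+ 2 * (s1 - s1 ^+ 2 / 2)))
  (12 * al / eps * r) S.
Proof.
have [a [b [/andP[ab bV] ra rb rab [sa sb1 sb2]]]] := giant_interval.
have aV := leq_trans (ltnW ab) bV.
pose L := act b :\: act a.
have Lbig : 4 * al * r < #|L|%:R.
  have [E0 E1 A0 A1] := And4 eps_gt0 eps_le al_gt0 al_le.
  have [AL2 SG R0] := And3 al2 s1_ge r_gt0.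
  have := act_diff (ltnW ab) bV; rewrite -/L ler_norml => /andP[h _].
  move: h sa sb1 sb2; set sA := a%:R / n; set sB := b%:R / n => h sa sb1 sb2.
  apply: (@lt_le_trans _ _ (c * (sB - sA) * r - 2 * al ^+ 2 * r)); last by lra.
  rewrite -mulrBl ltr_pM2r //.
  have : 1 * (sB - sA) <= c * (sB - sA) by rewrite ler_wpM2r //; lra.
  have : eps * al <= 1 / 100 * al by rewrite ler_wpM2r // ltW.
  by clear h sb2; lra.
have L0 : L != set0.
  apply: contraTneq Lbig => ->; rewrite cards0 -leNgt !mulr_ge0 //; exact: ltW.
have Lc : L \in components e S.
  exact: (interval_mem_components e_sym ab bV ra rb rab).
have small C : C \in components e S -> C != L -> (#|C| < #|L|)%N.
  case/(component_interval v0 e_sym) => a' [b' [abV' ra' rb' rab' CE]] CL.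
  rewrite -(ltr_nat R); apply: le_lt_trans Lbig.
  have [ab' bV'] := andP abV'.
  (* Two intervals between consecutive restarts coincide or do not overlap. *)
  have : [|| (b' <= a)%N, (b <= a')%N | (a' == a) && (b' == b)].
    case: (leqP b' a) => //= h1; case: (leqP b a') => //= h2; apply/andP; split.
      case: ltngtP => // h; first by have := rab' a; rewrite h h1 ra => /(_ isT).
      by have := rab a'; rewrite h h2 ra' => /(_ isT).
    case: ltngtP => // h; first by have := rab b'; rewrite h h1 rb' => /(_ isT).
    by have := rab' b; rewrite h h2 rb => /(_ isT).
  case/or3P => [b'a|ba'|/andP[/eqP a'E /eqP b'E]]; last first.
  - by rewrite CE a'E b'E eqxx in CL.
  - rewrite CE; apply: late_small => //.
    by rewrite (le_trans sb1) // ler_pM2r ?invr_gt0 // ler_nat.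
  - apply: le_trans (early_small aV sa).
    rewrite ler_nat CE subset_leq_card // (subset_trans (subsetDl _ _)) //.
    exact: active_subset.
have Lmax : largest_component e S L.
  rewrite /largest_component Lc /=; apply/forall_inP => C Cc.
  by have [->//|/(small _ Cc)/ltnW] := eqVneq C L.
apply/andP; split; first by apply/existsP; exists L.
apply/forallP => C; apply/implyP => /andP[Cc /forall_inP/(_ _ Lc) LC].
have -> : C = L by apply/eqP; apply: contraTT LC => /(small _ Cc); rewrite -ltnNge.
have -> : (nb_edges e L)%:R = (edges_between e (act b) (act b))%:R / 2 -
    (edges_between e (act a) (act a))%:R / 2 :> R.
  rewrite (interval_edges e_sym ab ra rb) -/L -(nb_edgesE e_sym e_irr) natrD -muln2 natrM.
  by field.
apply: (giant_edges_error (sA := a%:R / n) (sB := b%:R / n)) => //.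
- by rewrite ler_pdivrMr // mul1r ler_nat.
- exact: act_edges.
- exact: act_edges.
Qed.

End Giant.

(** * The fixed point and large degrees *)

(** The ratio (1 - exp (-y)) / y is strictly decreasing for y > 0. This comes from the tangent to
    exp at -a, evaluated at -b and, strictly, at 0. *)
Lemma fixpoint_unique (R : realType) (c a b : R) :
  0 < c -> 0 < a -> a < b -> a = c * (1 - expR (- a)) -> b = c * (1 - expR (- b)) -> False.
Proof.
move=> c0 a0 ab aE bE.
have b0 : 0 < b by exact: lt_trans ab.
have T1 := expR_tangent (- b) (- a); have T2 : expR (- a) * (1 + a) < 1.
  rewrite -[ltRHS](mulVf (lt0r_neq0 (expR_gt0 a))) -expRN ltr_pM2l ?expR_gt0 //.
  by rewrite expR_gt1Dx // gt_eqF.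
have ab0 : 0 < b - a by lra.
have H1 := ler_wpM2l (ltW a0) T1; have H2 : (b - a) * (expR (- a) * (1 + a)) < (b - a) * 1.
  by rewrite ltr_pM2l.
have E : a * (1 - expR (- b)) = b * (1 - expR (- a)).
  by apply: (mulfI (lt0r_neq0 c0)); rewrite mulrCA -bE mulrCA -aE mulrC.
have : a * (expR (- a) * (1 + (- b - - a))) + (b - a) * (expR (- a) * (1 + a)) = b * expR (- a).
  by ring.
by lra.
Qed.

Lemma fixpoint_exists (R : realType) (eps : R) : 0 < eps <= 1 / 100 ->
  exists x : R, unique (fun y : R => 0 < y < 1 /\ y = (1 + eps) * (1 - expR (- y))) x.
Proof.
move=> /andP[e0 e1]; set c := 1 + eps.
have c0 : 0 < c by rewrite /c; lra.
pose g (y : R) := c * (1 - expR (- y)) - y.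
(* Starting the interval at [eps] keeps away from the root 0. *)
have gc : {within `[eps, 1], continuous g}%classic.
  apply: continuous_subspaceT => y; apply: cvgB; last exact: cvg_id.
  apply: cvgM; first exact: cvg_cst.
  apply: cvgB; first exact: cvg_cst.
  by apply: continuous_comp; [exact: oppr_continuous | exact: continuous_expR].
have g1 : g eps >= 0.
  have := expRN_le (ltW e0) => H; rewrite /g subr_ge0.
  apply: (@le_trans _ _ (c * (eps - 3 / 4 * eps ^+ 2))); last first.
    by rewrite ler_pM2l //; lra.
  have -> : c * (eps - 3 / 4 * eps ^+ 2) = eps * (c * (1 - 3 / 4 * eps)) by ring.
  rewrite ler_peMr ?(ltW e0) // /c.
  have : eps ^+ 2 <= eps * (1 / 100) by rewrite expr2 ler_wpM2l // ltW.
  by lra.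
have g2 : g 1 < 0.
  have h : 1 / 4 <= expR (- 1) :> R.
    have -> : - 1 = 2%:R * (- (1 / 2)) :> R by field.
    rewrite expRM_natl (_ : 1 / 4 = (1 / 2) ^+ 2); last by field.
    have h2 : 1 / 2 <= expR (- (1 / 2)) :> R by apply: le_trans (expR_ge1Dx _); lra.
    by rewrite lerXn2r ?nnegrE ?expR_ge0.
  have : c * (1 - expR (- 1)) <= c * (3 / 4) by rewrite ler_pM2l //; lra.
  by rewrite /g /c; lra.
have [|x xI gx] := IVT (ltac:(lra) : eps <= 1) gc (v := 0).
  by rewrite ge_min le_max g1 (ltW g2) orbT.
have x1 : x < 1.
  move: xI; rewrite in_itv /= => /andP[_]; rewrite le_eqVlt => /orP[/eqP x1|//].
  by rewrite x1 in gx; move: g2; rewrite gx ltxx.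
have x0 : 0 < x by move: xI; rewrite in_itv /= => /andP[h _]; lra.
have xE : x = c * (1 - expR (- x)) by move: gx; rewrite /g; lra.
exists x; split; first by rewrite x0 x1.
move=> y [/andP[y0 y1] yE]; case: (ltrgtP x y) => // xy; exfalso.
  exact: (fixpoint_unique c0 x0 xy).
exact: (fixpoint_unique c0 y0 xy).
Qed.

Lemma prod_if_eq (R : realType) (V : finType) (A : {set V}) (v : V) (z : R) :
  \prod_(u in A) (if u == v then z else 1) = if v \in A then z else 1.
Proof.
case: ifP => vA.
  by rewrite (bigD1 v) //= eqxx big1 ?mulr1 // => u /andP[_ /negPf ->].
by rewrite big1 // => u uA; case: eqVneq => // uv; rewrite -uv uA in vA.
Qed.

Section DegreeTail.
Context (R : realType) (V : finType) (e : rel V) (p : R) (d : nat).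
Hypotheses (p_gt0 : 0 < p) (p_lt1 : p < 1).
Hypotheses (e_irr : irreflexive e) (e_deg : forall v, degin e setT v = d).

(* Being less than 2 ^+ M, it bounds by M the degrees inside S and by 1 the
   excess p * sum of (degree - M)^+ over all vertices. *)
Definition degree_moment (S : {set V}) : R :=
  \sum_v 2 ^+ degin e S v * ((v \in S)%:R + p).

Lemma degree_moment_ge0 S : 0 <= degree_moment S.
Proof.
apply: sumr_ge0 => v _; apply: mulr_ge0; first exact: exprn_ge0.
by rewrite addr_ge0 // ltW.
Qed.

(** For fixed [v] the summand factors over vertices: each neighbour contributes 2 p + (1 - p) = 1 +
    p, and [v] itself p (1 + p) + (1 - p) p = 2 p. *)
Lemma degree_moment_mean :
  \sum_(S : {set V}) subset_weight p S * degree_moment S = #|V|%:R * (2 * p * (1 + p) ^+ d).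
Proof.
under eq_bigr do rewrite /degree_moment mulr_sumr.
have -> : #|V|%:R * (2 * p * (1 + p) ^+ d) = \sum_(v : V) 2 * p * (1 + p) ^+ d.
  by rewrite sumr_const -[RHS]mulr_natl.
rewrite exchange_big /=.
apply: eq_bigr => v _.
pose f u := p * (if e v u then 2 else 1) * (if u == v then 1 + p else 1).
pose g u := (1 - p) * (if u == v then p else 1).
have E S : subset_weight p S * (2 ^+ degin e S v * ((v \in S)%:R + p)) =
   (\prod_(u in S) f u) * (\prod_(u in ~: S) g u).
  rewrite /subset_weight /f /g !big_split /= !prod_if_eq in_setC.
  have -> : \prod_(u in S) (if e v u then 2 else 1) = 2 ^+ degin e S v :> R.
    rewrite -big_mkcondr prodr_const; congr (_ ^+ _).
    by apply: eq_card => u; rewrite !inE.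
  by case: (v \in S) => /=; ring.
under eq_bigr do rewrite E.
rewrite sum_subset_prod (bigD1 v) //= /f /g eqxx e_irr mulr1.
have -> : \prod_(u | u != v) (p * (if e v u then 2 else 1) * (if u == v then 1 + p else 1)
    + (1 - p) * (if u == v then p else 1)) = (1 + p) ^+ d.
  rewrite -(e_deg v) -prodr_const.
  rewrite [RHS](bigID (fun u => u != v)) /= [X in _ = _ * X]big1 ?mulr1; last first.
    by move=> u /andP[uE /negPn /eqP uv]; move: uE; rewrite uv !inE e_irr.
  rewrite big_mkcond [RHS]big_mkcond /=; apply: eq_bigr => u _.
  by rewrite !inE /=; case: (u == v); case: (e v u) => //=; ring.
by ring.
Qed.

End DegreeTail.

(** * The typical exploration *)

Lemma edges_error (R : realType) (c z x1 x2 x3 x4 x5 : R) :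
  0 < c -> c <= 101 / 100 -> c ^+ 2 <= 11 / 10 -> 1 <= z -> 0 <= x2 -> x2 <= 1 ->
  `|x1| <= z / 4 -> `|x3| <= c * (z / 4) -> `|x4| <= c * (z / 4) ->
  `|x5| <= c ^+ 2 / 2 * z -> `|x1 - x2 + x3 - x4 - x5| <= 20 * z.
Proof.
move=> c0 c1 c2 z1 x20 x21.
have cz : c * (z / 4) <= 101 / 100 * (z / 4) by rewrite ler_wpM2r //; lra.
have cz2 : c ^+ 2 / 2 * z <= 11 / 20 * z by rewrite ler_wpM2r //; lra.
rewrite !ler_norml => /andP[a1 a2] /andP[a3 a4] /andP[a5 a6] /andP[a7 a8].
by apply/andP; split; lra.
Qed.

Section Assembly.
Context (R : realType) (n d : nat) (lam : R) (V : finType) (e : rel V) (v0 : V).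
Hypothesis Ge : ndl_graph n d lam e.
Variables (eps al : R) (M : nat).
Local Notation c := (1 + eps).
Local Notation p := (c / d%:R).
Local Notation r := (n%:R / d%:R).
Local Notation nxt := (bfs_next e v0).
Local Notation qd := (queried nxt).
Local Notation act := (active e v0).
Local Notation vx := (asked nxt).
Hypotheses (eps_gt0 : 0 < eps) (eps_le : eps <= 1 / 100).
Hypotheses (al_gt0 : 0 < al) (al_le : 100 * al <= eps / 100).
Hypotheses (n_gt0 : (0 < n)%N) (d_gt0 : (0 < d)%N) (lam_gt0 : 0 < lam).
Hypotheses (lam_le : lam / d%:R <= al ^+ 2) (p_le : p <= al ^+ 2 / 2).
Hypotheses (M_ge : 4 <= M%:R * al ^+ 2) (r_ge : 1 <= al ^+ 2 * r).

Let d0 : (0 : R) < d%:R. Proof. by rewrite ltr0n. Qed.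
Let n0 : (0 : R) < n%:R. Proof. by rewrite ltr0n. Qed.
Let r0 : 0 < r :> R. Proof. by rewrite divr_gt0. Qed.
Let c_gt0 : 0 < c. Proof. by rewrite addr_gt0. Qed.
Let p0 : 0 < p. Proof. by rewrite divr_gt0. Qed.
Let al2_le : al ^+ 2 <= 1 / 100.
Proof.
have [E0 E1 A0 A1] := And4 eps_gt0 eps_le al_gt0 al_le.
apply: (@le_trans _ _ (al * (1 / 100))); first by rewrite expr2 ler_wpM2l; lra.
by lra.
Qed.
Let p1 : p < 1. Proof. by rewrite (le_lt_trans p_le) //; have := al2_le; lra. Qed.
Let Vn : #|V| = n. Proof. by case: Ge. Qed.
Let es : symmetric e. Proof. by case: Ge. Qed.
Let ei : irreflexive e. Proof. by case: Ge. Qed.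
Let dg : forall v, degin e setT v = d. Proof. exact: ndl_degin Ge. Qed.
Let pd : p * d%:R = c. Proof. by rewrite divfK // gt_eqF. Qed.
Let lam_lt : lam < d%:R.
Proof.
have : lam / d%:R < 1 by rewrite (le_lt_trans lam_le) //; have := al2_le; lra.
by rewrite ltr_pdivrMr // mul1r.
Qed.
Let M0 : (0 : R) < M%:R.
Proof.
rewrite lt0r ler0n andbT; apply/eqP => M0.
by have := M_ge; rewrite M0 mul0r; lra.
Qed.
Let M_inv : M%:R^-1 <= al ^+ 2 / 4.
Proof.
have := M_ge; rewrite -ler_pdivrMl //; lra.
Qed.

Definition deviation (a : {set V} -> {set V} -> R) S t : R :=
  \sum_(j < t) incr p nxt a S (qd S j).

Definition coef_one (Q K : {set V}) : R := 1.
Definition coef_degree (Q K : {set V}) : R := (degin e Q (nxt Q K))%:R.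
(** Edges inside the active set number about n / d. Without the cap the coefficient is only bounded
    by d, which would give an error of order n. *)
Definition coef_capped (Q K : {set V}) : R := (minn (degin e K (nxt Q K)) M)%:R.

Lemma deviation_one S t : (t <= n)%N ->
  deviation coef_one S t = #|act S t|%:R - c * (t%:R / n%:R) * r.
Proof.
move=> tn; rewrite /deviation.
have -> : c * (t%:R / n%:R) * r = \sum_(j < t) p.
  by rewrite sumr_const card_ord -[RHS]mulr_natl; field; rewrite !gt_eqF.
rewrite -(sum_asked_active e v0 S) ?Vn // natr_sum -sumrB.
by apply: eq_bigr => j _; rewrite /incr /coef_one mul1r.
Qed.

Lemma deviation_degree S t : (t <= n)%N ->
  deviation coef_degree S t =
  (\sum_(j < t) (vx S j \in S) * degin e (qd S j) (vx S j))%:R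
  - p * ((edges_between e (qd S t) (qd S t))%:R / 2).
Proof.
move=> tn; rewrite -(sum_degin_queried v0 es ei S) ?Vn // -muln2 natrM mulfK //.
rewrite !natr_sum mulr_sumr -sumrB; apply: eq_bigr => j _.
rewrite /incr /coef_degree -/(active e v0 S j) -/(asked nxt S j) natrM.
by ring.
Qed.

Lemma deviation_capped S t :
  deviation coef_capped S t =
  (\sum_(j < t) (vx S j \in S) * minn (degin e (act S j) (vx S j)) M)%:R
  - p * (\sum_(j < t) minn (degin e (act S j) (vx S j)) M)%:R.
Proof.
rewrite !natr_sum mulr_sumr -sumrB; apply: eq_bigr => j _.
rewrite /incr /coef_capped -/(active e v0 S j) -/(asked nxt S j) natrM.
by ring.
Qed.

(** In the fourth event the ratio is squared because the coefficients reach [M]; the tolerated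
    deviation is again r / M. *)
Definition bad (S : {set V}) : bool :=
  [|| [exists t : 'I_#|V|.+1, M%:R^-1 * r * 1 <= `|deviation coef_one S t|],
      [exists t : 'I_#|V|.+1, M%:R^-1 * r * (8 * d%:R) <= `|deviation (unseen_coef e v0 p) S t|],
      [exists t : 'I_#|V|.+1, M%:R^-1 * r * d%:R <= `|deviation coef_degree S t|],
      [exists t : 'I_#|V|.+1, M%:R^-1 ^+ 2 * r * M%:R <= `|deviation coef_capped S t|]
    | 2 ^+ M <= degree_moment e p S].

(** Four maximal inequalities contribute 2 exponentials each, the weakest exponent being that of the
    capped process. Markov's inequality for [degree_moment] gives the rest, with mean at most 16 c r
    <= 17 r. *)
Lemma bad_prob : random_subset_prob p bad <=
  8 * expR (- (M%:R^-1 ^+ 4 * r / 16)) + 17 * r / 2 ^+ M.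
Proof.
have [E0 E1 A0 A1] := And4 eps_gt0 eps_le al_gt0 al_le.
have [P0 P1] := conj p0 p1.
have Mi0 : 0 < M%:R^-1 :> R by rewrite invr_gt0.
have Mi1 : M%:R^-1 <= 1 :> R by rewrite (le_trans M_inv) //; have := al2_le; lra.
have pV : p * #|V|%:R <= 2 * r.
  by rewrite Vn mulrAC -mulrA ler_pM2r //; lra.
have nP := @bfs_next_notin V e v0.
have M4 : 0 < (M%:R^-1 : R) <= 4 by apply/andP; split => //; lra.
have M42 : 0 < (M%:R^-1 ^+ 2 : R) <= 4.
  have := exprn_ile1 2 (ltW Mi0) Mi1.
  by move=> h; apply/andP; split; [rewrite exprn_gt0 | lra].
(* The power is at most exp ((d + 1) p / (1 - p)), where (d + 1) p = c + p. *)
have q8 : (1 - p)^-1 ^+ d.+1 <= 8.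
  have P2 : p <= 1 / 200 by rewrite (le_trans p_le) //; have := al2_le; lra.
  have q0 : 0 < 1 - p by lra.
  apply: (@le_trans _ _ (expR (p / (1 - p)) ^+ d.+1)).
    rewrite lerXn2r ?nnegrE ?expR_ge0 ?invr_ge0 ?(ltW q0) //.
    have q1E (x : R) : 0 < 1 - x -> (1 - x)^-1 = 1 + x / (1 - x).
      by move=> x0; field; rewrite gt_eqF.
    by rewrite [leLHS]q1E // expR_ge1Dx.
  rewrite -expRM_natl; apply: expR_le8; rewrite mulrA ler_pdivrMr //.
  have -> : d.+1%:R * p = c + p by rewrite -natr1 mulrDl mul1r mulrC pd.
  by lra.
have dR Q v : `|(degin e Q v)%:R| <= d%:R :> R.
  by rewrite ger0_norm // ler_nat -(dg v) degin_subset // subsetT.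
have h1 : forall Q K, `|coef_one Q K| <= 1 by move=> Q K; rewrite normr1.
have h2 : forall Q K, `|unseen_coef e v0 p Q K| <= 8 * d%:R.
  by move=> Q K; apply: unseen_coef_bound.
have h3 : forall Q K, `|coef_degree Q K| <= d%:R by move=> Q K; exact: dR.
have h4 : forall Q K, `|coef_capped Q K| <= M%:R.
  by move=> Q K; rewrite ger0_norm // ler_nat geq_minr.
have d8 : 0 < 8 * d%:R :> R by rewrite mulr_gt0.
have B1 := maximal_tail P0 P1 nP ltr01 r0 pV M4 h1.
have B2 := maximal_tail P0 P1 nP d8 r0 pV M4 h2.
have B3 := maximal_tail P0 P1 nP d0 r0 pV M4 h3.
have B4 := maximal_tail P0 P1 nP M0 r0 pV M42 h4.
have m0 : forall S, 0 <= degree_moment e p S by move=> S; exact: degree_moment_ge0.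
have B5 := prob_markov P0 P1 (exprn_gt0 M (ltr0Sn R 1)) m0.
rewrite (degree_moment_mean p ei dg) in B5.
have C5 : #|V|%:R * (2 * p * (1 + p) ^+ d) / 2 ^+ M <= 17 * r / 2 ^+ M.
  rewrite ler_pM2r ?invr_gt0 ?exprn_gt0 // Vn.
  have k1 : (1 + p) ^+ d <= 8.
    apply: (@le_trans _ _ (expR p ^+ d)).
      by rewrite lerXn2r ?nnegrE ?expR_ge0 ?expR_ge1Dx //; lra.
    by rewrite -expRM_natl mulrC pd; apply: expR_le8; lra.
  have -> : n%:R * (2 * p * (1 + p) ^+ d) = 2 * c * (1 + p) ^+ d * r.
    by field; rewrite gt_eqF.
  rewrite ler_pM2r //; apply: (@le_trans _ _ (2 * c * 8)); last by lra.
  by rewrite ler_pM2l // mulr_gt0.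
set E := expR _.
have C : expR (- (M%:R^-1 ^+ 2 * r / 16)) <= E.
  rewrite ler_expR lerN2 ler_pM2r // ler_pM2r //.
  by rewrite -[2%N]/(2 + 0)%N ler_wiXn2l // ltW.
have D4 : expR (- ((M%:R^-1 ^+ 2) ^+ 2 * r / 16)) = E by rewrite -exprM.
rewrite D4 in B4.
apply: le_trans (prob_subadd P0 P1 _ _) _.
have U := lerD B1 (le_trans (prob_subadd P0 P1 _ _) (lerD B2
   (le_trans (prob_subadd P0 P1 _ _) (lerD B3
   (le_trans (prob_subadd P0 P1 _ _) (lerD B4 (le_trans B5 C5))))))).
by apply: (le_trans U); move: C; lra.
Qed.

Section Good.
Variables (S : {set V}) (s1 : R).
Hypothesis good : ~~ bad S.
Hypotheses (s1_gt0 : 0 < s1) (s1_lt1 : s1 < 1) (s1E : s1 = survive eps s1).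

Let good_at (a : {set V} -> {set V} -> R) (x : R) t :
  ~~ [exists t : 'I_#|V|.+1, x <= `|deviation a S t|] -> (t <= n)%N ->
  `|deviation a S t| <= x.
Proof.
move=> /existsPn H tn; have tV : (t < #|V|.+1)%N by rewrite Vn.
by have := H (Ordinal tV); rewrite -ltNge => /ltW.
Qed.

Let goods : [/\ forall t, (t <= n)%N -> `|deviation coef_one S t| <= al ^+ 2 / 4 * r,
  forall t, (t <= n)%N -> `|deviation (unseen_coef e v0 p) S t| <= 2 * al ^+ 2 * n%:R,
  forall t, (t <= n)%N -> `|deviation coef_degree S t| <= al ^+ 2 / 4 * n%:R,
  forall t, (t <= n)%N -> `|deviation coef_capped S t| <= al ^+ 2 / 4 * r
  & degree_moment e p S < 2 ^+ M].
Proof.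
have rd : r * d%:R = n%:R :> R by rewrite divfK // gt_eqF.
move: good; rewrite /bad !negb_or => /and5P[g1 g2 g3 g4 g5].
split; last by rewrite ltNge.
- move=> t tn; rewrite (le_trans (good_at g1 tn)) // mulr1 ler_pM2r //.
- move=> t tn; rewrite (le_trans (good_at g2 tn)) //.
  have -> : M%:R^-1 * r * (8 * d%:R) = 8 * M%:R^-1 * n%:R :> R.
    by field; rewrite !gt_eqF.
  by rewrite ler_pM2r //; have := M_inv; lra.
- move=> t tn; rewrite (le_trans (good_at g3 tn)) //.
  by rewrite -mulrA rd ler_pM2r //.
- move=> t tn; rewrite (le_trans (good_at g4 tn)) //.
  have -> : M%:R^-1 ^+ 2 * r * M%:R = M%:R^-1 * r :> R.
    by field; rewrite !gt_eqF.
  by rewrite ler_pM2r //.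
Qed.

Lemma good_act t : (t <= n)%N ->
  `|#|act S t|%:R - c * (t%:R / n%:R) * r| <= al ^+ 2 * r.
Proof.
move=> tn; have [g1 _ _ _ _] := goods; rewrite -deviation_one //.
rewrite (le_trans (g1 t tn)) // ler_pM2r //.
by have := sqr_ge0 al; lra.
Qed.

Lemma good_nbhd t : (t <= n)%N ->
  `|#|nbhd e (act S t)|%:R - n%:R * survive eps (t%:R / n%:R)| <= 20 * al ^+ 2 * n%:R.
Proof.
move=> tn; have [_ g2 _ _ _] := goods.
have [E0 E1] := conj eps_gt0 eps_le.
have W : `|unseen_weight e p (qd S t) (act S t) - n%:R| <= 2 * al ^+ 2 * n%:R.
  rewrite unseen_weight_martingale ?Vn // addrAC subrr add0r.
  exact: g2.
have P2 : 0 < p <= 1 / 100.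
  by rewrite p0 (le_trans p_le) //; have := al2_le; lra.
have C1 : 1 <= c <= 11 / 10 by apply/andP; split; lra.
have := unseen_card Ge lam_gt0 lam_lt P2 pd C1 n_gt0 W.
rewrite card_queried ?Vn // => H; apply: (le_trans H).
rewrite ler_pM2r //.
have : c * (lam / d%:R) <= 101 / 100 * al ^+ 2.
  by apply: ler_pM => //; [exact: ltW | rewrite divr_ge0 // ltW | lra].
by have := p_le; lra.
Qed.

Lemma sum_asked_le (F : V -> R) t : (t <= n)%N -> (forall v, 0 <= F v) ->
  \sum_(j < t) F (vx S j) <= \sum_v F v.
Proof.
move=> tn F0.
have -> : \sum_(j < t) F (vx S j) = \sum_(v in qd S t) F v.
  elim: t tn => [|t IH] tn; first by rewrite big_ord0 big_set0.
  by rewrite big_ord_recr /= IH ?(ltnW tn) // queriedS big_setU1 1?addrC // asked_notin ?Vn.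
by rewrite [leRHS](bigID (fun v => v \in qd S t)) /= lerDl sumr_ge0.
Qed.

(** With [N j] the number of active neighbours of the j-th vertex that were queried before it, the
    edges inside the active set are the sum of [N j] over active queries, about p times the full sum
    T. The restart identity evaluates T as d |K| minus about p e(Q). The martingale controls only
    the capped sum T', hence the comparison of T and T'. *)
Lemma good_edges t : (t <= n)%N -> restart e v0 S t ->
  `|(edges_between e (act S t) (act S t))%:R / 2
     - r * (c ^+ 2 * (t%:R / n%:R - (t%:R / n%:R) ^+ 2 / 2))| <= 20 * al ^+ 2 * r.
Proof.
move=> tn rt; have tV : (t <= #|V|)%N by rewrite Vn.
have [g1 _ g3 g4 g5] := goods.
have [E0 E1] := conj eps_gt0 eps_le.
have sub j : act S j \subset S by rewrite /active subsetIr.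
pose N j := degin e (act S j) (vx S j).
(* The cap does not bind at active vertices: a degree above [M] inside [S] would push
   [degree_moment] to 2^M. *)
have SN : (\sum_(j < t) (vx S j \in S) * N j = \sum_(j < t) (vx S j \in S) * minn (N j) M)%N.
  apply: eq_bigr => j _; case: (boolP (vx S j \in S)) => // vS; rewrite !mul1n.
  apply/esym/minn_idPl; rewrite leqNgt; apply/negP => MN.
  move: g5; rewrite ltNge => /negP; apply.
  apply: (@le_trans _ _ (2 ^+ degin e S (vx S j) * ((vx S j \in S)%:R + p))).
    rewrite vS -[leLHS]mulr1; apply: ler_pM => //.
      by rewrite ler_weXn2l ?ler1n // ltnW // (leq_trans MN) // degin_subset.
    by rewrite lerDl ltW.
  rewrite /degree_moment (bigD1 (vx S j)) //= lerDl sumr_ge0 // => v _.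
  by rewrite mulr_ge0 ?exprn_ge0 // addr_ge0 // ltW.
pose T : R := (\sum_(j < t) N j)%:R; pose T' : R := (\sum_(j < t) minn (N j) M)%:R.
have T1 : 0 <= p * (T - T').
  by rewrite mulr_ge0 ?(ltW p0) // subr_ge0 ler_nat leq_sum // => j _; exact: geq_minl.
(* For all queries, the excess N - M is at most 2^(N - M), and the term [p] in [degree_moment] pays
   for the sum of these. *)
have T2 : p * (T - T') <= 1.
  have : T - T' <= \sum_(j < t) 2 ^+ degin e S (vx S j) / 2 ^+ M.
    rewrite /T /T' !natr_sum -sumrB; apply: ler_sum => j _.
    rewrite ler_pdivlMr ?exprn_gt0 //.
    have [NM|/ltnW NM] := leqP (N j) M.
      by rewrite subrr mul0r exprn_ge0.
    rewrite -natrB // -!natrX -natrM ler_nat.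
    apply: (@leq_trans (2 ^ (N j - M) * 2 ^ M)%N).
      by rewrite leq_mul2r ltnW ?orbT // ltn_expl.
    by rewrite -expnD subnK // leq_pexp2l // degin_subset.
  move=> H; have := sum_asked_le (F := fun v => 2 ^+ degin e S v / 2 ^+ M) tn
    (fun v => divr_ge0 (exprn_ge0 _ (ler0n _ _)) (exprn_ge0 _ (ler0n _ _))).
  move=> /(le_trans H) /(ler_wpM2l (ltW p0)) H2; apply: (le_trans H2).
  rewrite -mulr_suml mulrA ler_pdivrMr ?exprn_gt0 // mul1r.
  apply: le_trans (ltW g5); rewrite mulr_sumr; apply: ler_sum => v _.
  by rewrite mulrC ler_wpM2l ?exprn_ge0 // lerDr.
have I5 : (edges_between e (act S t) (act S t))%:R / 2 =
    (\sum_(j < t) (vx S j \in S) * N j)%:R :> R.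
  by rewrite -(sum_degin_active_active v0 es ei S tV) -muln2 natrM mulfK.
have I4 : T + (\sum_(j < t) (vx S j \in S) * degin e (qd S j) (vx S j))%:R =
    d%:R * #|act S t|%:R.
  rewrite -natrM -(restart_edges es dg rt) -(sum_degin_active v0 es ei S tV).
  by rewrite -natrD -big_split.
have D4 := g4 t tn; rewrite deviation_capped -SN -I5 -/T' in D4.
have D3 := g3 t tn; rewrite deviation_degree // in D3.
have D1 := g1 t tn; rewrite deviation_one // in D1.
have Q0 := edges_between_deviation Ge lam_gt0 lam_lt (qd S t).
rewrite card_queried // in Q0.
move: D1 D3 D4 Q0; set s := t%:R / n%:R.
set X := (edges_between e (act S t) _)%:R / 2; set Kt : R := #|act S t|%:R; set BD := (\sum_(j < t) _)%:R.
set EQ := (edges_between e (qd S t) _)%:R => D1 D3 D4 Q0.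
have tE : t%:R = s * n%:R by rewrite /s divfK // gt_eqF.
have F1 : `|c * Kt - c ^+ 2 * s * r| <= c * (al ^+ 2 / 4 * r).
  have -> : c * Kt - c ^+ 2 * s * r = c * (Kt - c * s * r) by ring.
  by rewrite normrM (gtr0_norm c_gt0) ler_pM2l.
have F3 : `|p * (BD - p * (EQ / 2))| <= c * (al ^+ 2 / 4 * r).
  rewrite normrM (gtr0_norm p0).
  have -> : c * (al ^+ 2 / 4 * r) = p * (al ^+ 2 / 4 * n%:R) by field; rewrite gt_eqF.
  by rewrite ler_pM2l.
have F0 : `|p ^+ 2 * (EQ / 2) - c ^+ 2 * s ^+ 2 / 2 * r| <= c ^+ 2 / 2 * (al ^+ 2 * r).
  have -> : p ^+ 2 * (EQ / 2) - c ^+ 2 * s ^+ 2 / 2 * r =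
     p ^+ 2 / 2 * (EQ - d%:R * t%:R ^+ 2 / n%:R).
    by rewrite tE; field; rewrite !gt_eqF.
  rewrite normrM ger0_norm; last by rewrite divr_ge0 ?sqr_ge0.
  apply: (@le_trans _ _ (p ^+ 2 / 2 * (lam * n%:R))).
    by rewrite ler_wpM2l // divr_ge0 ?sqr_ge0.
  have -> : p ^+ 2 / 2 * (lam * n%:R) = c ^+ 2 / 2 * (lam / d%:R * r).
    by field; rewrite gt_eqF.
  by rewrite ler_wpM2l ?divr_ge0 ?sqr_ge0 // ler_pM2r.
(* The restart identity multiplied by [p], with the centred form of [BD] singled out. *)
have key : p * T = c * Kt - p * (BD - p * (EQ / 2)) - p ^+ 2 * (EQ / 2).
  have -> : T = d%:R * Kt - BD by rewrite -I4; ring.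
  have -> : c * Kt = p * (d%:R * Kt) by rewrite mulrA pd.
  by ring.
have XE : X - r * (c ^+ 2 * (s - s ^+ 2 / 2)) = (X - p * T') - p * (T - T')
   + (c * Kt - c ^+ 2 * s * r) - p * (BD - p * (EQ / 2))
   - (p ^+ 2 * (EQ / 2) - c ^+ 2 * s ^+ 2 / 2 * r).
  have -> : p * (T - T') = p * T - p * T' by ring.
  by rewrite key; ring.
rewrite XE.
have zE : al ^+ 2 / 4 * r = al ^+ 2 * r / 4 by ring.
rewrite zE in D4 F1 F3; rewrite -[20 * al ^+ 2 * r]mulrA.
by apply: (edges_error c_gt0) => //; [lra | exact: sqr_1D_le].
Qed.

Lemma good_giant : edges_L1_within e (r * (c ^+ 2 * (s1 - s1 ^+ 2 / 2)))
  (12 * al / eps * r) S.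
Proof.
apply: (@giant_edges R V e v0 es ei eps al s1 r S) => //.
- have a2 := sqr_ge0 al; rewrite Vn (le_trans r_ge) // ler_wpM2l // ler_pdivrMr //.
  by rewrite ler_peMr ?(ltW n0) // ler1n.
- by move=> t; rewrite Vn; exact: good_act.
- by move=> t; rewrite Vn; exact: good_nbhd.
- by move=> t; rewrite Vn; exact: good_edges.
Qed.

End Good.

Lemma giant_prob s1 : 0 < s1 -> s1 < 1 -> s1 = survive eps s1 ->
  1 - (8 * expR (- (M%:R^-1 ^+ 4 * r / 16)) + 17 * r / 2 ^+ M) <=
  random_subset_prob p
    (edges_L1_within e (r * (c ^+ 2 * (s1 - s1 ^+ 2 / 2))) (12 * al / eps * r)).
Proof.
move=> h1 h2 h3; rewrite prob_predC //; apply: lerB => //.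
apply: le_trans bad_prob; apply: prob_le => // S; apply: contraR => g.
exact: good_giant.
Qed.

End Assembly.

(** * Asymptotics *)

(** The bound 256 L^10 is 16 L^2 times (2 L^2)^4, as needed for a cutoff M <= 2 L^2. It follows from
    exp L >= (L / 11)^11, the spare factor L absorbing the constant. *)
Lemma expR_ge_pow10 (R : realType) : exists2 K : R, 100 <= K &
  forall L, K <= L -> 256 * L ^+ 10 <= expR L.
Proof.
have K0 : 0 <= 256 * 11%:R ^+ 11 :> R.
  by apply: mulr_ge0; [exact: ler0n | apply: exprn_ge0; exact: ler0n].
exists (256 * 11%:R ^+ 11 + 100) => [|L]; first by rewrite lerDr.
move: K0; set K := 256 * _ => K0 KL.
have L0 : 0 <= L by lra.
have eE : expR L = expR (L / 11%:R) ^+ 11 by rewrite -expRM_natl; congr expR; field.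
rewrite eE; apply: (@le_trans _ _ ((L / 11%:R) ^+ 11)).
  rewrite expr_div_n ler_pdivlMr ?exprn_gt0 // mulrAC -/K [leRHS]exprS.
  by rewrite ler_wpM2r ?exprn_ge0 //; lra.
rewrite lerXn2r ?nnegrE ?expR_ge0 ?divr_ge0 //.
by apply: le_trans (expR_ge1Dx _); lra.
Qed.

(** Here L = ln r and M is about L^2. Both terms are bounded by multiples of exp (L - L^2 / 2), the
    second because 2 >= exp (1 / 2); the total factor 25 is at most exp 5. *)
Lemma failure_bound (R : realType) (L r : R) (M : nat) :
  100 <= L -> 256 * L ^+ 10 <= r -> r = expR L -> L ^+ 2 <= M%:R <= L ^+ 2 + 1 ->
  8 * expR (- (M%:R^-1 ^+ 4 * r / 16)) + 17 * r / 2 ^+ M <=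
  expR (- (1 / 10 * L ^+ 2)).
Proof.
move=> L100 rL rE /andP[ML MU].
have L2 : 100 * L <= L ^+ 2 by rewrite expr2 ler_wpM2r //; lra.
have M0 : 0 < M%:R :> R by lra.
have r0 : 0 < r by rewrite rE expR_gt0.
have h1 : expR (- (M%:R^-1 ^+ 4 * r / 16)) <= expR (L - L ^+ 2 / 2).
  rewrite ler_expR.
  suff : L ^+ 2 <= M%:R^-1 ^+ 4 * r / 16 by lra.
  have M4 : M%:R ^+ 4 <= 16 * L ^+ 8.
    apply: (@le_trans _ _ ((2 * L ^+ 2) ^+ 4)).
      by rewrite lerXn2r ?nnegrE //; lra.
    by rewrite exprMn -exprM -natrX.
  rewrite ler_pdivlMr // exprVn [leRHS]mulrC ler_pdivlMr ?exprn_gt0 //.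
  apply: le_trans rL.
  apply: (@le_trans _ _ (L ^+ 2 * 16 * (16 * L ^+ 8))).
    by rewrite ler_wpM2l // mulr_ge0 ?sqr_ge0.
  by rewrite le_eqVlt; apply/orP; left; apply/eqP; ring.
have h2 : r / 2 ^+ M <= expR (L - L ^+ 2 / 2).
  rewrite expRD -rE ler_pM2l // expRN lef_pV2 ?posrE ?exprn_gt0 ?expR_gt0 //.
  apply: (@le_trans _ _ (expR (1 / 2) ^+ M)).
    by rewrite -expRM_natl ler_expR; lra.
  by rewrite lerXn2r ?nnegrE ?expR_ge0 // expR_half_le.
have h3 : 25 <= expR 5 :> R.
  have -> : 5 = 5%:R * 1 :> R by rewrite mulr1.
  rewrite expRM_natl; apply: (@le_trans _ _ (2 ^+ 5)); first by rewrite -natrX ler_nat.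
  by rewrite lerXn2r ?nnegrE ?expR_ge0 //; have := expR_ge1Dx (1 : R); lra.
apply: (@le_trans _ _ (25 * expR (L - L ^+ 2 / 2))).
  have -> : 17 * r / 2 ^+ M = 17 * (r / 2 ^+ M) by rewrite mulrA.
  by move: h1 h2; set A := expR _; set B := r / _; set C := expR _; lra.
apply: (@le_trans _ _ (expR 5 * expR (L - L ^+ 2 / 2))).
  by rewrite ler_wpM2r ?expR_ge0.
by rewrite -expRD ler_expR; lra.
Qed.

Lemma edges_L1_within_le (R : realType) (V : finType) (e : rel V) (c err err' : R) S :
  err <= err' -> edges_L1_within e c err S -> edges_L1_within e c err' S.
Proof.
move=> le_err /andP[h1 /forallP h2]; rewrite /edges_L1_within h1 /=.
apply/forallP => C; apply/implyP => hC; have := h2 C; rewrite hC /= => h.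
exact: le_trans le_err.
Qed.

(** With b = al^(1/4) < eps^2, the left side is 12 b b^3 / eps, and b^3 <= eps^6. *)
Lemma powR_quarter_bound (R : realType) (eps al : R) : 0 < eps <= 1 / 100 ->
  0 < al -> al < eps ^+ 8 -> 12 * al / eps <= 8 * al `^ (1 / 4).
Proof.
move=> /andP[e0 e1] a0 a8; set b := al `^ (1 / 4).
have b0 : 0 < b by rewrite /b powR_gt0.
have b4 : b ^+ 4 = al.
  by rewrite -powR_mulrn ?(ltW b0) // -powRrM (_ : 1 / 4 * 4%:R = 1) ?powRr1 ?(ltW a0) //; field.
have be : b <= eps ^+ 2.
  rewrite leNgt; apply/negP => h.
  have : (eps ^+ 2) ^+ 4 < b ^+ 4 by rewrite ltrXn2r ?nnegrE ?sqr_ge0 ?(ltW b0).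
  by rewrite -exprM b4 ltNge (ltW a8).
rewrite ler_pdivrMr // -b4.
have b3 : b ^+ 3 <= eps ^+ 6.
  by rewrite (_ : eps ^+ 6 = (eps ^+ 2) ^+ 3) ?lerXn2r ?nnegrE ?(ltW b0) ?sqr_ge0 // -exprM.
have -> : 12 * b ^+ 4 = b * (12 * b ^+ 3) by ring.
have -> : 8 * b * eps = b * (8 * eps) by ring.
rewrite ler_pM2l //.
have : eps ^+ 6 <= eps ^+ 2 by rewrite ler_wiXn2l ?(ltW e0) //; lra.
have : eps ^+ 2 <= eps * (1 / 100) by rewrite expr2 ler_pM2l.
by lra.
Qed.

Lemma small_alpha (R : realType) (eps al : R) : 0 < eps <= 1 / 100 ->
  0 < al -> al < eps ^+ 8 -> 100 * al <= eps / 100 /\ al ^+ 2 <= 1 / 100.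
Proof.
move=> /andP[e0 e1] a0 a8.
have e2 : eps ^+ 2 <= eps * (1 / 100) by rewrite expr2 ler_pM2l.
have e3 : eps ^+ 3 <= eps * (1 / 100) * (1 / 100).
  by rewrite exprSr; apply: ler_pM => //; [exact: sqr_ge0 | exact: ltW].
have e8 : eps ^+ 8 <= eps ^+ 3 by rewrite ler_wiXn2l ?(ltW e0) //; lra.
have al_le : 100 * al <= eps / 100 by lra.
split=> //.
have : al ^+ 2 <= al * (1 / 100) by rewrite expr2 ler_pM2l //; lra.
by lra.
Qed.

Lemma powR_le_sqr (R : realType) (al : R) : 0 < al <= 1 -> al `^ (2 / al) <= al ^+ 2.
Proof.
move=> /andP[a0 a1]; rewrite -powR_mulrn ?(ltW a0) // /powR gt_eqF // ler_expR.
apply: ler_wnM2r; first exact: ln_le0.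
by rewrite ler_pdivlMr //; lra.
Qed.

(** From lam^2 >= d / 2 follows 1 / d <= 2 (lam / d)^2 <= 2 al^4, so the spectral gap makes the
    degree large and [p] small. *)
Lemma ndl_density (R : realType) (n d : nat) (lam eps al : R) (V : finType)
    (e : rel V) :
  ndl_graph n d lam e -> (0 < n)%N -> (0 < d)%N -> d%:R / n%:R <= 1 / 2 :> R ->
  eps <= 1 / 100 -> al ^+ 2 <= 1 / 100 -> lam / d%:R <= al ^+ 2 ->
  0 < lam /\ (1 + eps) / d%:R <= al ^+ 2 / 2.
Proof.
move=> Ge n_gt0 d_gt0 dn2 e1 al2 lam_le.
have d0 : (0 : R) < d%:R by rewrite ltr0n.
have lam0 : 0 <= lam.
  by case: Ge => _ _ _ _ [s _ [_ ->]]; rewrite le_max normr_ge0.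
have lam_lt : lam < d%:R.
  have : lam / d%:R < 1 by lra.
  by rewrite ltr_pdivrMr // mul1r.
have lam22 : d%:R / 2 <= lam ^+ 2.
  by apply: le_trans (lam_sqr_ge Ge lam_lt n_gt0); rewrite ler_pM2l //; lra.
have d_inv : d%:R^-1 / 2 <= (lam / d%:R) ^+ 2.
  have -> : d%:R^-1 / 2 = d%:R / 2 / d%:R ^+ 2 :> R by field; rewrite gt_eqF.
  by rewrite expr_div_n ler_pM2r ?invr_gt0 ?exprn_gt0.
split.
  rewrite lt_neqAle lam0 andbT; apply/eqP => l0.
  by move: lam22; rewrite -l0 expr0n /=; lra.
have a4 : (lam / d%:R) ^+ 2 <= al ^+ 2 * (1 / 100).
  rewrite expr2; apply: ler_pM => //; try (by rewrite divr_ge0 // ltW).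
  exact: le_trans al2.
have : (1 + eps) * d%:R^-1 <= 101 / 100 * d%:R^-1.
  by rewrite ler_pM2r ?invr_gt0 //; lra.
by have := sqr_ge0 al; lra.
Qed.

(** The lower bound al > 2 / L enters here: with M just above L^2 it gives M al^2 >= 4. *)
Lemma degree_cutoff (R : realType) (al L r : R) : 0 < al -> 100 <= L -> 2 < al * L ->
  256 * L ^+ 10 <= r -> exists M : nat,
  [/\ L ^+ 2 <= M%:R <= L ^+ 2 + 1, 4 <= M%:R * al ^+ 2 & 1 <= al ^+ 2 * r].
Proof.
move=> a0 L100 aL rL.
have aL2 : 4 <= al ^+ 2 * L ^+ 2.
  have h : 2 ^+ 2 <= (al * L) ^+ 2 by rewrite lerXn2r ?nnegrE //; lra.
  by rewrite exprMn in h; lra.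
have /andP[h1 h2] : (Num.truncn (L ^+ 2))%:R <= L ^+ 2 < (Num.truncn (L ^+ 2)).+1%:R.
  by apply: truncn_itv; exact: sqr_ge0.
exists (Num.truncn (L ^+ 2)).+1; split.
- by rewrite (ltW h2) /= -natr1 lerD2r.
- by apply: (le_trans aL2); rewrite mulrC ler_wpM2r ?sqr_ge0 // ltW.
- apply: (@le_trans _ _ (al ^+ 2 * L ^+ 2)); first by lra.
  rewrite ler_wpM2l ?sqr_ge0 // (le_trans _ rL) //.
  have : L ^+ 2 <= L ^+ 10 by rewrite ler_weXn2l //; lra.
  by have := sqr_ge0 L; lra.
Qed.

Lemma giant_edges_prob (R : realType) (eps x K al lam : R) (n d : nat)
    (V : finType) (e : rel V) :
  0 < eps <= 1 / 100 -> 0 < x < 1 -> x = (1 + eps) * (1 - expR (- x)) ->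
  100 <= K -> (forall L, K <= L -> 256 * L ^+ 10 <= expR L) ->
  (0 < n)%N -> (3 <= d)%N -> (d%:R / n%:R : R) < expR (- K) ->
  let r : R := n%:R / d%:R in
  2 / ln r < al -> al < eps ^+ 8 -> ndl_graph n d lam e ->
  lam / d%:R <= al `^ (2 / al) ->
  1 - r `^ (- (1 / 10) * ln (ln r)) <=
    random_subset_prob ((1 + eps) / d%:R)
      (edges_L1_within e
         (((1 + eps) ^+ 2 - (1 + eps - x) ^+ 2) * n%:R / (2 * d%:R))
         (8 * al `^ (1 / 4) * n%:R / d%:R)).
Proof.
move=> epsI xI xE K100 HK n_gt0 d3 dnK r alL al8 Ge lamal.
have [e0 e1] := andP epsI; have [x0 x1] := andP xI.
have d_gt0 : (0 < d)%N by exact: leq_trans d3.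
have n0 : (0 : R) < n%:R by rewrite ltr0n.
have d0 : (0 : R) < d%:R by rewrite ltr0n.
have r0 : 0 < r by rewrite divr_gt0.
set L := ln r in alL *.
have rL : expR L = r by rewrite lnK.
(* The density condition d / n < exp (-K) is a lower bound on L = ln (n / d). *)
have KL : K <= L.
  rewrite -ler_expR rL -[expR K]invrK -expRN -[r]invrK invf_ple ?posrE ?invr_gt0 ?expR_gt0 //.
  by rewrite invrK /r invf_div ltW.
have L100 : 100 <= L by exact: le_trans KL.
have L0 : 0 < L by exact: lt_le_trans L100.
have al0 : 0 < al by rewrite (lt_trans _ alL) // divr_gt0.
have alL2 : 2 < al * L by rewrite -ltr_pdivrMr.
have [al_le al2] := small_alpha epsI al0 al8.
have al1 : 0 < al <= 1.
  rewrite al0 /= ltW // (lt_trans al8) // exprn_ilt1 ?(ltW e0) //.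
  by apply: le_lt_trans e1 _; rewrite ltr_pdivrMr // mul1r ltr1n.
have lam_le := le_trans lamal (powR_le_sqr al1).
have dn2 : d%:R / n%:R <= 1 / 2 :> R.
  apply: (le_trans (ltW dnK)); rewrite expRN mul1r lef_pV2 ?posrE ?expR_gt0 //.
  apply: le_trans (expR_ge1Dx _); apply: (@le_trans _ _ K); last by rewrite lerDr.
  by apply: le_trans K100; rewrite ler_nat.
have [lam_gt0 p_le] := ndl_density Ge n_gt0 d_gt0 dn2 e1 al2 lam_le.
have r_large : 256 * L ^+ 10 <= r by rewrite -rL; exact: HK.
have [M [MI M_ge r_ge]] := degree_cutoff al0 L100 alL2 r_large.
have p_lt1 : (1 + eps) / d%:R < 1 by apply: (le_lt_trans p_le); clear -al2; lra.
have /card_gt0P[v0 _] : (0 < #|V|)%N by case: Ge => _ _ ->.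
set c := 1 + eps.
have c0 : 0 < c by rewrite addr_gt0.
(* This rescaling turns x = c (1 - exp (-x)) into the fixed point equation of [survive], and (c^2 -
   (c - x)^2) / 2 into c^2 (s1 - s1^2 / 2). *)
pose s1 := x / c.
have cs1 : c * s1 = x by rewrite /s1 mulrC divfK // gt_eqF.
have s1_gt0 : 0 < s1 by rewrite divr_gt0.
have s1_lt1 : s1 < 1 by rewrite ltr_pdivrMr // mul1r (lt_trans x1) // ltrDl.
have s1E : s1 = survive eps s1.
  by apply: (mulfI (lt0r_neq0 c0)); rewrite /survive -/c cs1.
have := giant_prob v0 Ge e0 e1 al0 al_le n_gt0 d_gt0 lam_gt0 lam_le p_le M_ge r_ge
  s1_gt0 s1_lt1 s1E.
rewrite -/r -/c => H.
apply: (@le_trans _ _ (1 - (8 * expR (- (M%:R^-1 ^+ 4 * r / 16)) + 17 * r / 2 ^+ M))).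
  apply: lerB => //.
  apply: le_trans (failure_bound L100 r_large (esym rL) MI) _.
  rewrite /powR gt_eqF // ler_expR -/L.
  have lnL : ln L <= L by exact: ltW (ln_sublinear L0).
  have -> : - (1 / 10) * ln L * L = - (1 / 10 * (ln L * L)) by ring.
  by rewrite lerN2 ler_pM2l // expr2 ler_pM2r.
have P0 : 0 < c / d%:R by rewrite divr_gt0.
apply: (le_trans H); apply: (prob_le P0 p_lt1) => S.
have -> : (c ^+ 2 - (c - x) ^+ 2) * n%:R / (2 * d%:R) =
   r * (c ^+ 2 * (s1 - s1 ^+ 2 / 2)).
  by rewrite -cs1 /r; field; rewrite gt_eqF.
apply: edges_L1_within_le.
rewrite -[leRHS]mulrA ler_pM2r //; exact: powR_quarter_bound.
Qed.

Local Open Scope classical_set_scope.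

Theorem theorem4 (R : realType) :
  exists2 eps0 : R, 0 < eps0 & forall eps : R, 0 < eps -> eps < eps0 ->
  exists2 x : R,
    unique (fun y : R => 0 < y < 1 /\ y = (1 + eps) * (1 - expR (- y))) x &
  exists2 beta : R, 0 < beta &
  forall d : nat -> nat,
  ((d n)%:R / n%:R : R) @[n --> \oo] --> (0 : R) ->
  \forall n \near \oo, forall (alpha lam : R) (V : finType) (e : rel V),
  (3 <= d n)%N ->
  let dn : R := (d n)%:R in
  let r : R := n%:R / dn in
  2 / ln r < alpha -> alpha < eps ^+ 8 ->
  ndl_graph n (d n) lam e ->
  lam / dn <= alpha `^ (2 / alpha) ->
  1 - r `^ (- beta * ln (ln r)) <=
    random_subset_prob ((1 + eps) / dn)
      (edges_L1_within e
         (((1 + eps) ^+ 2 - (1 + eps - x) ^+ 2) * n%:R / (2 * dn))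
         (8 * alpha `^ (1 / 4) * n%:R / dn)).
Proof.
(* The numerical estimates above assume [eps <= 1 / 100]. *)
exists (1 / 100); first by lra.
move=> eps eps0 eps1.
have epsI : 0 < eps <= 1 / 100 by rewrite eps0 ltW.
have [x [[xI xE] xu]] := fixpoint_exists epsI.
exists x; first by split.
(* The constant of [failure_bound], the same for every [eps]. *)
exists (1 / 10); first by lra.
move=> d dn.
have [K K100 HK] := @expR_ge_pow10 R.
(* The hypothesis d = o(n) serves to make ln (n / d) exceed the absolute threshold [K]. *)
have /cvgrPdist_lt/(_ _ (expR_gt0 (- K))) near_d := dn.
near=> n.
move=> al lam V e d3 alL al8 Ge lamal.
have n_gt0 : (0 < n)%N by near: n; exact: nbhs_infty_gt.
apply: (giant_edges_prob epsI xI xE K100 HK n_gt0 d3 _ alL al8 Ge lamal).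
have : `|0 - (d n)%:R / n%:R| < expR (- K) by near: n.
by rewrite sub0r normrN ger0_norm ?divr_ge0.
Unshelve. all: by end_near.
Qed.
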